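(* Assume the standing setting described in the context (spaces $H,V,V_{\xi_n(\omega)}$; operators $A(t)$, $A_{\xi_n}(t)$ with exponent $p\in[2,\infty)$; data $u_0\in H$, $f$, $f_{\xi_n}$; mutually independent random variables $\xi_n$; constants $\kappa,\lambda$; grid $0=t_0<t_1<\dots<t_N=T$ with $h_n=t_n-t_{n-1}$, $h=\max_n h_n$). Further, let $f_{\xi_n}\in C([0,T];H)$ almost surely and let $f^n=f_{\xi_n}(t_n)\in L^2(\Omega;H)$ for all $n\in\{1,\dots,N\}$. Let $\{U^n\}_{n\in\{1,\dots,N\}}$ be the solution of the scheme $$U^n-U^{n-1}+h_nA_{\xi_n}(t_n)U^n=h_nf^n\ \text{ in }V_{\xi_n}^*,\quad n\in\{1,\dots,N\},\qquad U^0=u_0\ \text{ in }H,$$ and let $u$ be the solution of $$u'(t)+A(t)u(t)=f(t)\ \text{ in }V^*,\quad t\in(0,T],\qquad u(0)=u_0\ \text{ in }H,$$ and suppose $u'\in C^{\gamma}([0,T];H)$ for some $\gamma\in(0,1]$. Moreover, let $A_{\xi_n}(t_n)u(t_n)\in L^2(\Omega;H)$ for all $n\in\{1,\dots,N\}$. Here the values $f(t_n)$ at the grid points are the ones given by the equation, $f(t_n)=u'(t_n)+A(t_n)u(t_n)$, and $\mathbb{E}_{\xi_n}[f_{\xi_n}(t_n)]=f(t_n)$ holds at the grid points $t_n$, $n\in\{1,\dots,N\}$. Then, if $2\kappa h_n\le 2\kappa h<1$, the errors $e^n=U^n-u(t_n)$ satisfy, for all $n\in\{1,\dots,N\}$,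 $$\begin{aligned} &\mathbb{E}_n\big[\|e^n\|_H^2\big]+\frac12\sum_{i=1}^{n}\mathbb{E}_i\big[\|e^i-e^{i-1}\|_H^2\big]+2\sum_{i=1}^{n}h_i\,\mathbb{E}_i\big[\eta_{\xi_i}|e^i|_{V_{\xi_i}}^p\big]\\ &\quad\le 8hC\sum_{i=1}^{N}h_i\,\mathbb{E}_{\xi_i}\big[\big\|f_{\xi_i}(t_i)-A_{\xi_i}(t_i)u(t_i)-(f(t_i)-A(t_i)u(t_i))\big\|_H^2\big]\\ &\qquad+4h^{1+2\gamma}C\,|u'|_{C^{\gamma}([0,T];H)}^2\,T+5h^{2\gamma}C^2\,|u'|_{C^{\gamma}([0,T];H)}^2\,T^2, \end{aligned}$$ where $C=\frac{1}{1-2h\kappa}\exp\big(\frac{2\kappa T}{1-2h\kappa}\big)$.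
   Context: Spaces. $(H,(\cdot,\cdot)_H,\|\cdot\|_H)$ is a real separable Hilbert space; $(V,\|\cdot\|_V)$ is a real separable reflexive Banach space continuously and densely embedded in $H$, and $|\cdot|_V$ is a semi-norm on $V$. Identifying $H\cong H^*$ gives $V\hookrightarrow H\hookrightarrow V^*$. Condition (A) for a family of operators. Let $T\in(0,\infty)$, $p\in[2,\infty)$. A family $A(t)\colon V\to V^*$, $t\in[0,T]$, satisfies Condition (A) with constants $\kappa_A,\eta_A,\beta_A,\mu_A,\lambda_A\in[0,\infty)$ (independent of $t$) if: (i) for every $v\in V$, $t\mapsto A(t)v\in V^*$ is continuous almost everywhere in $(0,T)$; (ii) for all $t$ and $v,w\in V$, $s\mapsto\langle A(t)(v+sw),w\rangle_{V^*\times V}$ is continuous on $[0,1]$; (iii) $\langle A(t)v-A(t)w,v-w\rangle_{V^*\times V}+\kappa_A\|v-w\|_H^2\ge\eta_A|v-w|_V^p$ for all $v,w\in V$; (iv) $\|A(t)v\|_{V^*}\le\beta_A(1+\|v\|_V^{p-1})$ for all $v\in V$; (v) $\langle A(t)v,v\rangle_{V^*\times V}+\kappa_A\|v\|_H^2+\lambda_A\ge\mu_A|v|_V^p$ for all $v\in V$. Standing setting. The family $\{A(t)\}_{t\in[0,T]}$ satisfies Condition (A) on $V,H,V^*$; $f\in L^2(0,T;H)$ and $u_0\in H$. $(\Omega,\mathcal F,\mathcal P)$ is a complete probability space and $\{\xi_n\}_{n\in\mathbb N}$ are mutually independent random variables. $\mathcal F_0$ is the $\sigma$-algebra generated by the null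 sets, $\mathcal F_n=\sigma(\sigma(\xi_1,\dots,\xi_n)\cup\mathcal F_0)$ and $\mathcal F_{\xi_n}=\sigma(\sigma(\xi_n)\cup\mathcal F_0)$. For $\xi=\xi_n$, each $n$, the following holds. For almost every $\omega$ there is a real Banach space $V_{\xi(\omega)}$ (satisfying the same requirements as $V$) with a semi-norm $|\cdot|_{V_{\xi(\omega)}}$ such that $V\hookrightarrow V_{\xi(\omega)}\hookrightarrow H$ continuously and densely, and $\bigcap_{\omega\in\Omega}V_{\xi(\omega)}=V$; for every $v\in H$, $\{\omega: v\in V_{\xi(\omega)}\}\in\mathcal F_\xi$. For almost every $\omega$, the family $\{A_{\xi(\omega)}(t)\}_{t\in[0,T]}$, $A_{\xi(\omega)}(t)\colon V_{\xi(\omega)}\to V_{\xi(\omega)}^*$, satisfies Condition (A) with $V_{\xi(\omega)},H,V_{\xi(\omega)}^*$ (same $p$) and constants $\kappa_{\xi(\omega)},\eta_{\xi(\omega)},\beta_{\xi(\omega)},\mu_{\xi(\omega)},\lambda_{\xi(\omega)}$. For $v\in V$, $A_\xi(t)v\colon\Omega\to V^*$ is $\mathcal F_\xi$-measurable and $\mathbb E_\xi[A_\xi(t)v]=A(t)v$ in $V^*$. The maps $\kappa_\xi,\eta_\xi,\mu_\xi,\beta_\xi,\lambda_\xi\colon\Omega\to[0,\infty)$ are measurable, and there are $\kappa,\lambda\in[0,\infty)$ with $\kappa_\xi\le\kappa$ almost surely and $\mathbb E_\xi[\lambda_\xi]\le\lambda$. Finally $f_{\xi(\omega)}\in L^2(0,T;H)$,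 $f_\xi(t)\colon\Omega\to H$ is $\mathcal F_\xi$-measurable and $\mathbb E_\xi[f_\xi(t)]=f(t)$ in $H$ for almost all $t\in(0,T)$. Notation. $\mathbb E_\xi$ is expectation with respect to the distribution of $\xi$, and $\mathbb E_n[X]=\mathbb E_{\xi_1}[\mathbb E_{\xi_2}[\dots\mathbb E_{\xi_n}[X]\dots]]$ (the total expectation for $\mathcal F_n$-measurable $X$). $C^\gamma([0,T];H)$ is the space of $H$-valued Hölder continuous functions of exponent $\gamma$ (Lipschitz for $\gamma=1$), with semi-norm $|w|_{C^\gamma([0,T];H)}=\sup_{s\ne t}\|w(t)-w(s)\|_H/|t-s|^\gamma$. A solution $\{U^n\}$ of the scheme consists of $\mathcal F_n$-measurable maps $U^n\colon\Omega\to H$ with $U^n(\omega)\in V_{\xi_n(\omega)}$ such that the equation holds in $V_{\xi_n(\omega)}^*$ for almost every $\omega$. The exact solution $u$ takes values $u(t)\in V$ for $t\in(0,T]$. *)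

(* Defs.v *)
From HB Require Import structures.
From mathcomp Require Import all_boot all_order all_algebra ring lra.
From mathcomp Require Import all_classical all_reals all_analysis.

Set Implicit Arguments.
Unset Strict Implicit.
Unset Printing Implicit Defensive.

Import Order.TTheory GRing.Theory Num.Theory.
Import numFieldNormedType.Exports.

Local Open Scope classical_set_scope.
Local Open Scope ring_scope.

Section dual_space.
Context (R : realType) (V : normedModType R).

Definition dual_pred : {pred (V -> R)} :=
  mem [set f : V -> R | linear f /\ continuous f].

Record dual := Dual { dual_fun :> V -> R; dual_funP : dual_fun \in dual_pred }.

HB.instance Definition _ := [isSub for dual_fun].
HB.instance Definition _ := [Choice of dual by <:].

Lemma dual_submod_closed : submod_closed dual_pred.
Proof.
split=> [|a f g]; rewrite !inE /=.
  split; first by move=> a x y; rewrite /= scaler0 addr0.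
  by move=> x; exact: cst_continuous.
move=> [lf cf] [lg cg]; split.
  move=> b x y; rewrite !fctE /= lf lg !scalerDr !scalerA mulrC.
  by rewrite addrACA.
move=> x; apply: (@continuousD _ _ _ (fun y => a * f y) g); last exact: cg.
by apply: continuousZr; exact: cf.
Qed.

HB.instance Definition _ :=
  GRing.isSubmodClosed.Build R (V -> R) dual_pred dual_submod_closed.
HB.instance Definition _ := [SubChoice_isSubLmodule of dual by <:].

Lemma dual_linear (f : dual) : linear f.
Proof. by have := dual_funP f; rewrite inE => -[]. Qed.

HB.instance Definition _ (f : dual) :=
  GRing.isLinear.Build R V R *:%R f (dual_linear f).

Lemma dual_continuous (f : dual) : continuous f.
Proof. by have := dual_funP f; rewrite inE => -[]. Qed.

Definition dual_norm (f : dual) : R :=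
  sup [set `|f x| | x in [set x : V | `|x| <= 1]].

Lemma dual_has_ubound (f : dual) :
  has_ubound [set `|f x| | x in [set x : V | `|x| <= 1]].
Proof.
have /linear_boundedP/pinfty_ex_gt0[M M0 fM] :
    bounded_near (f : {linear V -> R}) (nbhs (0 : V)).
  by apply/linear_bounded_continuous; exact: dual_continuous.
exists M => _ [y /= y1 <-]; rewrite (le_trans (fM y))//.
by rewrite ler_piMr// ltW.
Qed.

Lemma dual_norm_ge0 (f : dual) : 0 <= dual_norm f.
Proof.
rewrite (@le_trans _ _ `|f 0|)//; apply: ub_le_sup; first exact: dual_has_ubound.
by exists 0 => //=; rewrite normr0.
Qed.

Lemma dual_norm_le (f : dual) (M : R) :
  (forall x : V, `|x| <= 1 -> `|f x| <= M) -> dual_norm f <= M.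
Proof.
move=> fM; apply: ge_sup => [|_ [x /= x1 <-]]; last exact: fM.
by exists `|f 0|, 0 => //=; rewrite normr0.
Qed.

Lemma dual_le_norm (f : dual) (x : V) : `|f x| <= dual_norm f * `|x|.
Proof.
have [->|x0] := eqVneq x 0; first by rewrite linear0 !normr0 mulr0.
rewrite -ler_pdivrMr ?normr_gt0//.
apply: ub_le_sup; first exact: dual_has_ubound.
exists (`|x|^-1 *: x) => /=.
  by rewrite normrZ normfV normr_id mulVf// normr_eq0.
by rewrite linearZ/= normrM normfV normr_id mulrC.
Qed.

Lemma dual_le_norm1 (f : dual) (x : V) : `|x| <= 1 -> `|f x| <= dual_norm f.
Proof.
by move=> x1; rewrite (le_trans (dual_le_norm f x))// ler_piMr// dual_norm_ge0.
Qed.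

Lemma dual_normD (f g : dual) : dual_norm (f + g) <= dual_norm f + dual_norm g.
Proof.
apply: dual_norm_le => x x1; rewrite (_ : (f + g) x = f x + g x)//.
by rewrite (le_trans (ler_normD _ _))// lerD// dual_le_norm1.
Qed.

Lemma dual_normZ (a : R) (f : dual) : dual_norm (a *: f) = `|a| * dual_norm f.
Proof.
have normZ_le b g : dual_norm (b *: g) <= `|b| * dual_norm g.
  apply: dual_norm_le => x x1; rewrite (_ : (b *: g) x = b * g x)// normrM.
  by rewrite ler_wpM2l// dual_le_norm1.
have [->|a0] := eqVneq a 0.
  apply/eqP; rewrite normr0 mul0r eq_le dual_norm_ge0 andbT.
  by rewrite (le_trans (normZ_le _ _))// normr0 mul0r.
apply/eqP; rewrite eq_le normZ_le/= -ler_pdivlMl ?normr_gt0//.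
by rewrite -normfV -[in leLHS](scalerK a0 f).
Qed.

Lemma dual_norm0_eq0 (f : dual) : dual_norm f = 0 -> f = 0.
Proof.
move=> f0; apply: val_inj; apply/funext => x /=.
by apply/eqP; rewrite -normr_le0 (le_trans (dual_le_norm f x))// f0 mul0r.
Qed.

HB.instance Definition _ := Lmodule_isNormed.Build R dual
  dual_normD dual_normZ dual_norm0_eq0.

End dual_space.

HB.mixin Record isHilbert (R : realType) H & CompleteNormedModule R H := {
  hdot : {dot H for (idfun : R -> R)};
  hdot_norm : forall x : H, hdot x x = `|x| ^+ 2
}.

#[short(type="hilbertType")]
HB.structure Definition Hilbert (R : realType) :=
  {H of isHilbert R H & CompleteNormedModule R H}.

Section hilbert_theory.
Context (R : realType) (H : hilbertType R).
Implicit Types x y : H.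

Lemma hdotC x y : hdot x y = hdot y x.
Proof. by rewrite (@hermitian_subproof _ _ _ _ hdot) expr0 mul1r. Qed.

Lemma hdotPl a x y z : hdot (a *: x + y) z = a * hdot x z + hdot y z.
Proof. exact: linearPl. Qed.

Lemma hdotPr a x y z : hdot z (a *: x + y) = a * hdot z x + hdot z y.
Proof. by rewrite !(hdotC z) hdotPl. Qed.

Lemma hdot0r x : hdot x 0 = 0.
Proof.
by have := hdotPr (- 1) x x x; rewrite scaleN1r addNr mulN1r addNr.
Qed.

Lemma hdotZr a x z : hdot z (a *: x) = a * hdot z x.
Proof. by have := hdotPr a x 0 z; rewrite addr0 hdot0r addr0. Qed.

Lemma hdot_le_norm x y : `|hdot x y| <= `|x| * `|y|.
Proof.
have [->|y0] := eqVneq y 0; first by rewrite hdot0r !normr0 mulr0.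
have n0 : 0 < `|y| ^+ 2 by rewrite exprn_gt0// normr_gt0.
have := sqr_ge0 `| - hdot x y *: y + `|y| ^+ 2 *: x|.
rewrite -hdot_norm hdotPl !hdotPr !hdotZr (hdotC y x) !hdot_norm.
set c := hdot x y; set a := `|x| ^+ 2; set n := `|y| ^+ 2 => cn.
rewrite -ler_sqr ?nnegrE ?mulr_ge0// exprMn real_normK ?num_real//.
move: cn; rewrite !(hdotC (n *: x)) !hdotZr (hdotC y) hdot_norm -/c -/a => cn.
by rewrite -(ler_pM2r n0) -/n -/c -/a; nra.
Qed.

End hilbert_theory.

Definition separable (X : topologicalType) :=
  exists2 A : set X, countable A & dense A.

Definition reflexive_space (R : realType) (X : normedModType R) :=
  forall F : dual (dual X), exists x : X, forall f : dual X, F f = f x.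

Definition is_seminorm (R : realType) (X : lmodType R) (s : X -> R) :=
  (forall x y, s (x + y) <= s x + s y) /\
  (forall a x, s (a *: x) = `|a| * s x).

Section embedded_banach.
Context (R : realType) (H : hilbertType R).

Record embedded_banach := EmbeddedBanach {
  eb_sort :> completeNormedModType R;
  emb : {linear eb_sort -> H};
  semi : eb_sort -> R;
  emb_continuous : continuous emb;
  emb_inj : injective emb;
  emb_dense : dense (range emb);
  eb_separable : separable eb_sort;
  eb_reflexive : reflexive_space eb_sort;
  semi_seminorm : is_seminorm semi
}.

Implicit Types V W : embedded_banach.

Lemma to_dual_subproof V (h : H) :
  (fun v : V => hdot h (emb V v)) \in @dual_pred R V.
Proof.
have f_linear : linear (fun v : V => hdot h (emb V v)).
  by move=> a x y; rewrite linearP hdotPr.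
rewrite inE; split => //.
pose F : {linear V -> R} :=
  HB.pack (fun v : V => hdot h (emb V v))
    (GRing.isLinear.Build R V R *:%R _ f_linear).
suff : bounded_near F (nbhs (0 : V)) by move/linear_bounded_continuous.
have /linear_boundedP/pinfty_ex_gt0[M M0 embM] :=
  continuous_linear_bounded 0 (@emb_continuous V 0).
apply/linear_boundedP; near=> r => x.
rewrite (le_trans (hdot_le_norm _ _))//.
rewrite (@le_trans _ _ (`|h| * M * `|x|))// -?mulrA ?ler_wpM2l// mulrA.
rewrite ler_wpM2r//; near: r; exact: nbhs_pinfty_ge.
Unshelve. all: by end_near. Qed.

(* The embedding of H = H^* into V^* *)
Definition to_dual V (h : H) : dual V := Dual (to_dual_subproof V h).

(* h as an element of V, when it lies in the range of emb V (0 otherwise) *)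
Definition vlift V (h : H) : V := xget 0 [set v | emb V v = h].

(* phi as an element of H, when it lies in the range of to_dual V (0 otherwise);
   unique because emb V has dense range *)
Definition to_H V (phi : dual V) : H := xget 0 [set h | to_dual V h = phi].

Definition densely_embeds V W := exists j : {linear V -> W},
  [/\ continuous j, dense (range j) & forall v, emb W (j v) = emb V v].

(* When densely_embeds V W, the image of phi under W^* -> V^* (phi composed with
   the embedding of V into W) *)
Definition restrict_dual V W (phi : dual W) : dual V :=
  xget 0 [set psi : dual V | forall v, psi v = phi (vlift W (emb V v))].

End embedded_banach.

Record condition_A (R : realType) (H : hilbertType R) (V : embedded_banach H)
    (T p : R) (A : R -> V -> dual V) (kappa eta beta mu lambda : R) : Prop := {
  condA_ge0 :
    [/\ 0 <= kappa, 0 <= eta, 0 <= beta, 0 <= mu & 0 <= lambda];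
  condA_ae_continuous : forall v, {ae lebesgue_measure, forall t : R,
    0 < t < T -> {for t, continuous (fun s => A s v)}};
  condA_hemicontinuous : forall t v w, 0 <= t <= T ->
    {within `[0, 1], continuous (fun s : R => A t (v + s *: w) w)};
  condA_monotone : forall t v w, 0 <= t <= T ->
    eta * semi (v - w) `^ p <=
    (A t v - A t w) (v - w) + kappa * `|emb V (v - w)| ^+ 2;
  condA_growth : forall t v, 0 <= t <= T ->
    `|A t v| <= beta * (1 + `|v| `^ (p - 1));
  condA_coercive : forall t v, 0 <= t <= T ->
    mu * semi v `^ p <= A t v v + kappa * `|emb V v| ^+ 2 + lambda
}.

(* For a sigma-algebra F on D: measurability of f on D, X carrying its Borel
   sets *)
Definition measurable_wrt (S : Type) (X : topologicalType)
    (F : set (set S)) (D : set S) (f : S -> X) :=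
  forall O, open O -> F (D `&` f @^-1` O).

Section bochner.
Context d (S : measurableType d) (R : realType) (B : normedModType R).

(* f represents a class of L^2(D; B).  Borel measurability of g suffices as B is
   always separable below. *)
Definition square_integrable (mu : {measure set S -> \bar R}) (D : set S)
    (f : S -> B) :=
  exists g : S -> B, [/\ measurable_wrt measurable D g,
    (\int[mu]_(x in D) (`|g x| ^+ 2)%:E < +oo)%E &
    {ae mu, forall x, D x -> f x = g x}].

Definition simple_fun (l : seq (set S * B)) (w : S) : B :=
  \sum_(a <- l) \1_(a.1) w *: a.2.

Definition simple_mean (P : probability S R) (l : seq (set S * B)) : B :=
  \sum_(a <- l) fine (P a.1) *: a.2.

(* X is Bochner integrable with mean m: m is the limit of the means of simple
   maps approximating X in L^1.  Such maps need not be written with disjoint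
   sets. *)
Definition has_expectation (P : probability S R) (X : S -> B) (m : B) :=
  measurable_wrt measurable [set: S] X /\
  exists l : nat -> seq (set S * B),
  [/\ forall k a, a \in l k -> measurable a.1,
      (fun k => \int[P]_w (`|X w - simple_fun (l k) w|)%:E)%E @ \oo --> 0%E &
      (fun k => simple_mean P (l k)) @ \oo --> m].

End bochner.

Section filtration.
Context d (Om : measurableType d) (R : realType) (P : probability Om R).
Context (dE : nat -> measure_display) (E : forall n, measurableType (dE n)).
Variable xi : forall n, {RV P >-> E n}.

(* The sequence starts at index 1: xi 0 is not part of it. *)
Definition mutually_independent :=
  forall (J : seq nat) (B : forall n, set (E n)), uniq J ->
    (forall n, n \in J -> (0 < n)%N /\ measurable (B n)) ->
    P (\bigcap_(n in [set` J]) (xi n @^-1` B n)) =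
    (\prod_(n <- J) P (xi n @^-1` B n))%E.

Definition sigma_null : set (set Om) := <<s [set N | P.-negligible N] >>.

Definition sigma_of n : set (set Om) :=
  preimage_set_system [set: Om] (xi n) measurable.

Definition sigma_xi n : set (set Om) := <<s sigma_of n `|` sigma_null >>.

Definition sigma_past n : set (set Om) :=
  <<s <<s \bigcup_(i in [set i | (1 <= i <= n)%N]) sigma_of i >>
      `|` sigma_null >>.

End filtration.

Definition step (R : realType) (t : nat -> R) (n : nat) : R := t n - t n.-1.

Definition mesh (R : realType) (t : nat -> R) (N : nat) : R :=
  \big[Num.max/0]_(1 <= n < N.+1) step t n.

Section hoelder.
Context (R : realType) (B : normedModType R).

Definition hoelder_quotients (T gamma : R) (w : R -> B) : set R :=
  [set q | exists s t, [/\ 0 <= s <= T, 0 <= t <= T, s != t &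
    q = `|w t - w s| / `|t - s| `^ gamma]].

Definition hoelder_on (T gamma : R) (w : R -> B) :=
  has_ubound (hoelder_quotients T gamma w).

Definition hoelder_seminorm (T gamma : R) (w : R -> B) : R :=
  sup (hoelder_quotients T gamma w).

End hoelder.

(* u' is the derivative of u as a V^*-valued map on ]0, T[; f is only determined
   almost everywhere, hence so is the equation. *)
Record evolution_solution (R : realType) (H : hilbertType R)
    (V : embedded_banach H) (T : R) (A : R -> V -> dual V) (f : R -> H)
    (u0 : H) (u u' : R -> H) : Prop := {
  evolution_init : u 0 = u0;
  evolution_continuous : {within `[0, T], continuous u};
  evolution_in_V : forall t, 0 < t <= T -> range (emb V) (u t);
  evolution_derive : forall t : R, 0 < t < T ->
    is_derive t 1 (fun s => to_dual V (u s)) (to_dual V (u' t));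
  evolution_eq : {ae lebesgue_measure, forall t : R, 0 < t < T ->
    to_dual V (u' t) + A t (vlift V (u t)) = to_dual V (f t)}
}.

(* Main.v *)
Require Import Defs.
From HB Require Import structures.
From mathcomp Require Import all_boot all_order all_algebra ring lra.
From mathcomp Require Import all_classical all_reals all_analysis.
From mathcomp Require Import measurable_realfun.

Set Implicit Arguments.
Unset Strict Implicit.
Unset Printing Implicit Defensive.

Import Order.TTheory GRing.Theory Num.Theory.
Import numFieldNormedType.Exports.

Local Open Scope classical_set_scope.
Local Open Scope ring_scope.

(* Write e^n = U^n - u(t_n), g^n = f_xi(t_n) - A_xi(t_n) u(t_n) - u'(t_n) and
   r^n = h_n u'(t_n) - (u(t_n) - u(t_{n-1})).  Subtracting the equations, testing
   with e^n in V_xi and using the monotonicity of A_xi gives almost surely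
     (1 - 2 kappa h_n) |e^n|^2 + |e^n - e^{n-1}|^2 / 2 + 2 h_n eta |e^n|_V^p
       <= |e^{n-1}|^2 + 2 h_n^2 |g^n|^2 + 2 h_n (g^n, e^{n-1}) + 2 |r^n| |e^n|.
   As g^n has mean zero and is independent of e^{n-1}, the mixed term vanishes in
   expectation, and |r^n| is at most h_n h^gamma |u'|_{C^gamma}.  The discrete
   Gronwall inequality then bounds the sum on the left by
     4 h C sum_i h_i E|g^i|^2 + 4 h^(2 gamma) C^2 |u'|_{C^gamma}^2 T^2. *)

(** * Lower integrals and the discrete Gronwall inequality *)

(** Three gaps in regularity shape the proof. The semi-norm term is not known to be measurable in
    the sample, so its expectation is a lower integral, which is superadditive but in general not
    additive; the one-step estimate is therefore integrated with this term alone on the small side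
    of an inequality between nonnegative maps. Measurability and mean of A_xi u are given in the
    dual of [V], so g^n is known to have mean zero only when paired with vectors of [V], whereas
    e^{n-1} need not lie in [V]; the mixed term is removed by approximating e^{n-1}, on countably
    many events of the past, by vectors of [V] that are dense in [H]. Finally, measurability of f_xi
    is given at almost every time only, and reaches the grid points through continuity of the paths.
    Square integrability of e^n is not assumed: it is carried from step to step together with the
    estimate, starting from e^0 = 0. *)

Section lower_integral.
Context d (S : measurableType d) (R : realType).
Variable mu : {measure set S -> \bar R}.
Local Open Scope ereal_scope.

Import HBNNSimple.

(** The integral of a nonnegative map is a supremum over the simple maps below it, so monotonicity
    survives without measurability. *)
Lemma ge0_le_integral_nonmeasurable (f g : S -> \bar R) :
  (forall x, 0 <= f x) -> (forall x, f x <= g x) ->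
  \int[mu]_x f x <= \int[mu]_x g x.
Proof.
move=> f0 fg; rewrite !ge0_integralTE//; last first.
  by move=> x; exact: le_trans (fg x).
apply: le_ereal_sup => _ [h /= hf <-]; exists h => //= x.
exact: le_trans (fg x).
Qed.

(* [f2] need not be measurable: its integral is a supremum over the simple maps
   below it. *)
Lemma ae_ge0_integralD_le (f1 f2 g : S -> \bar R) :
  (forall x, 0 <= f1 x) -> measurable_fun [set: S] f1 ->
  (forall x, 0 <= f2 x) ->
  (forall x, 0 <= g x) -> measurable_fun [set: S] g ->
  {ae mu, forall x, f1 x + f2 x <= g x} ->
  \int[mu]_x f1 x + \int[mu]_x f2 x <= \int[mu]_x g x.
Proof.
move=> f10 mf1 f20 g0 mg fg.
have key (h : {nnsfun S >-> R}) : (forall x, (h x)%:E <= f2 x) ->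
    \int[mu]_x f1 x + sintegral mu h <= \int[mu]_x g x.
  move=> hf2; rewrite -integralT_nnsfun -ge0_integralD//=; last 2 first.
    by move=> x _; rewrite lee_fin.
    exact/measurable_EFinP.
  apply: ae_ge0_le_integral => //.
  - by move=> x _; rewrite adde_ge0// lee_fin.
  - by apply: emeasurable_funD => //; exact/measurable_EFinP.
  - apply: filterS fg => x fg _; apply: le_trans fg.
    by rewrite leeD2l.
(* A finite [\int f1] can be moved across the inequality; if it is infinite, [key] for the zero
   simple map already makes the right-hand side infinite. *)
have [fin|inf] := boolP (\int[mu]_x f1 x \is a fin_num).
  rewrite [X in _ + X]ge0_integralTE// -leeBrDl//.
  apply: ge_ereal_sup => _ [h /= hf2 <-].
  by rewrite leeBrDl//; exact: key.
have := key nnsfun0 f20; rewrite sintegral0 adde0.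
have -> : \int[mu]_x f1 x = +oo.
  by apply/eqP; move: inf; rewrite ge0_fin_numE ?integral_ge0// -leNgt leye_eq.
by rewrite leye_eq => /eqP ->; exact: leey.
Qed.
End lower_integral.

(* The discrete Gronwall inequality gives
   [X n <= C * (b + T * (dl * M + rho ^+ 2 / dl))] with [M] the largest [X n];
     for
   [dl = (2 * C * T)^-1] the term with [M] is absorbed. *)
Section gronwall.
Context (R : realType).
Variables (N : nat) (h a y b : nat -> R) (kappa T hm rho : R).
Hypothesis kappa_ge0 : 0 <= kappa.
Hypothesis h_gt0 : forall n, (1 <= n <= N)%N -> 0 < h n.
Hypothesis h_le : forall n, (1 <= n <= N)%N -> h n <= hm.
Hypothesis kh : 2 * kappa * hm < 1.
Hypothesis hT : \sum_(1 <= i < N.+1) h i = T.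
Hypothesis T_gt0 : 0 < T.
Hypothesis a0 : a 0%N = 0.
Hypothesis a_ge0 : forall n, 0 <= a n.
Hypothesis y_ge0 : forall n, 0 <= y n.
Hypothesis b_ge0 : forall n, 0 <= b n.

Let C := (1 - 2 * hm * kappa)^-1 * expR (2 * kappa * T / (1 - 2 * hm * kappa)).
Let X n := a n + \sum_(1 <= i < n.+1) y i.

Lemma sum_nat_le (c : nat -> R) n : (forall i, 0 <= c i) -> (n <= N)%N ->
  \sum_(1 <= i < n.+1) c i <= \sum_(1 <= i < N.+1) c i.
Proof.
move=> c0 nN; rewrite (big_cat_nat (n := n.+1) (p := N.+1))//=.
by rewrite lerDl sumr_ge0.
Qed.

Lemma sequence_argmax (c : nat -> R) m :
  exists2 k, (k <= m)%N & forall n, (n <= m)%N -> c n <= c k.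
Proof.
elim: m => [|m [k km ck]]; first by exists 0%N => // n;
  rewrite leqn0 => /eqP ->.
have [cm|cm] := leP (c m.+1) (c k).
  exists k; first exact: leqW.
  by move=> n; rewrite leq_eqVlt ltnS => /predU1P[->//|/ck].
exists m.+1 => // n; rewrite leq_eqVlt ltnS => /predU1P[->//|/ck].
by move=> /le_trans; apply; exact: ltW.
Qed.

Let q := 1 - 2 * hm * kappa.

Let q_gt0 : 0 < q. Proof. by rewrite /q subr_gt0 mulrAC. Qed.

Let q_le1 : (0 < N)%N -> q <= 1.
Proof.
move=> N0; have h1 : 0 < h 1 by apply: h_gt0.
have h1m : h 1 <= hm by apply: h_le.
by rewrite /q gerBl !mulr_ge0//; lra.
Qed.

(** Dividing by [1 - 2 * kappa * h n] costs at most a factor [expR (2 * kappa * h n / q)], and these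
    factors multiply to the exponential of the elapsed time. As [q <= 1], the product stays below
    [C]. *)
Lemma discrete_gronwall (c : nat -> R) :
  (forall n, 0 <= c n) ->
  (forall n, (1 <= n <= N)%N ->
    (1 - 2 * kappa * h n) * a n + y n <= a n.-1 + c n) ->
  forall n, (n <= N)%N -> X n <= C * \sum_(1 <= i < N.+1) c i.
Proof.
move=> c0 rec.
pose E n := expR (2 * kappa * (\sum_(1 <= i < n.+1) h i) / q).
have E_ge0 n : 0 <= E n by exact: expR_ge0.
suff XE n : (n <= N)%N -> X n <= E n * \sum_(1 <= i < n.+1) c i.
  move=> n nN; apply: le_trans (XE n nN) _.
  (* The case [n = 0] is apart because [q <= 1] needs at least one grid step. *)
  case: n nN => [|n] nN.
    rewrite big_geq// mulr0 mulr_ge0 ?sumr_ge0// mulr_ge0 ?expR_ge0//.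
    by rewrite invr_ge0 ltW.
  apply: ler_pM => //; [exact: sumr_ge0| |exact: sum_nat_le].
  rewrite /E /C -[leLHS]mul1r; apply: ler_pM => //.
    by rewrite invf_ge1//; apply: q_le1; exact: leq_ltn_trans nN.
  rewrite ler_expR -/q ler_pM2r ?invr_gt0// ler_wpM2l ?mulr_ge0//.
  rewrite -hT (big_cat_nat (n := n.+2) (p := N.+1))//= lerDl.
  rewrite big_nat sumr_ge0// => i /andP[ni iN]; apply/ltW/h_gt0.
  by rewrite -(ltnS i) iN andbT (leq_trans _ ni).
elim: n => [|n IH] nN.
  by rewrite /X !big_geq// a0 mulr0 addr0.
have n1N : (1 <= n.+1 <= N)%N by [].
have {}IH := IH (ltnW nN).
have hn := h_gt0 n1N; have hnm := h_le n1N.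
have qn : q <= 1 - 2 * kappa * h n.+1.
  by have := ler_wpM2l kappa_ge0 hnm; rewrite /q; lra.
set p := 1 - 2 * kappa * h n.+1 in qn.
have p_gt0 : 0 < p by exact: lt_le_trans qn.
have p_le1 : p <= 1 by rewrite /p gerBl !mulr_ge0// ltW.
have sumS (v : nat -> R) :
    \sum_(1 <= i < n.+2) v i = \sum_(1 <= i < n.+1) v i + v n.+1.
  by rewrite big_nat_recr.
(* Use [1 + x <= expR x] with [x = 2 * kappa * h n.+1 / q]: since [q <= p], [p * (1 + x) >= p + 2 *
   kappa * h n.+1 = 1]. *)
have pE : p^-1 * E n <= E n.+1.
  rewrite /E sumS mulrDr mulrDl expRD mulrC ler_pM2l ?expR_gt0//.
  apply: le_trans (expR_ge1Dx _); rewrite -(ler_pM2l p_gt0) divff ?gt_eqF//.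
  rewrite mulrDr mulr1 -lerBlDl {1}/p opprB addrC subrK.
  rewrite mulrCA ler_peMr ?mulr_ge0 ?(ltW hn)//.
  by rewrite -[leLHS](@mulfV _ q) ?gt_eqF// ler_pM2r// invr_gt0.
(* Multiplying by [p] also shrinks the earlier [y i], which is harmless because [p <= 1]. *)
have XpX : X n.+1 <= p^-1 * (X n + c n.+1).
  rewrite -(ler_pM2l p_gt0) mulrA divff ?gt_eqF// mul1r /X sumS.
  have := rec n.+1 n1N; rewrite -/p /= => {}rec.
  set s := \sum_(1 <= i < n.+1) y i.
  have s0 : 0 <= s by exact: sumr_ge0.
  have := y_ge0 n.+1; nra.
apply: le_trans XpX _; rewrite sumS mulrDr [leRHS]mulrDr lerD//.
  apply: (@le_trans _ _ (p^-1 * (E n * \sum_(1 <= i < n.+1) c i))).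
    by rewrite ler_pM2l ?invr_gt0.
  by rewrite mulrA ler_wpM2r ?sumr_ge0.
rewrite ler_wpM2r//; apply: le_trans pE;
  rewrite ler_peMr ?invr_ge0 ?(ltW p_gt0)//.
rewrite -expR0 ler_expR !mulr_ge0 ?invr_ge0 ?(ltW q_gt0)//.
rewrite big_nat sumr_ge0// => i /andP[i1 iN]; apply/ltW/h_gt0.
by rewrite i1 (leq_trans _ nN)// ltnW.
Qed.

Lemma gronwall_absorption : (0 < N)%N ->
  (forall n (dl : R), (1 <= n <= N)%N -> 0 < dl ->
    (1 - 2 * kappa * h n) * a n + y n <=
    a n.-1 + b n + h n * (dl * a n + rho ^+ 2 / dl)) ->
  forall n, (n <= N)%N ->
  X n <= 2 * C * \sum_(1 <= i < N.+1) b i + 4 * C ^+ 2 * T ^+ 2 * rho ^+ 2.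
Proof.
move=> N0 rec; have [k kN Xmax] := sequence_argmax X N.
have C_gt0 : 0 < C by rewrite mulr_gt0 ?invr_gt0 ?expR_gt0.
pose dl := (2 * C * T)^-1.
have dl_gt0 : 0 < dl by rewrite invr_gt0 mulr_gt0// mulr_gt0.
have X_ge0 n : 0 <= X n by apply: addr_ge0 => //; exact: sumr_ge0.
have aX n : (n <= N)%N -> a n <= X k.
  by move=> nN; apply: le_trans (Xmax n nN); rewrite lerDl sumr_ge0.
(* The absolute value makes [c] nonnegative at every index; [h] is known to be positive only between
   1 and [N]. *)
pose c n := b n + `|h n| * (dl * X k + rho ^+ 2 / dl).
have m_ge0 : 0 <= dl * X k + rho ^+ 2 / dl.
  have dl0 := ltW dl_gt0; apply: addr_ge0; first exact: mulr_ge0.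
  by apply: mulr_ge0; [exact: sqr_ge0|rewrite invr_ge0].
have c0 n : 0 <= c n by rewrite /c addr_ge0// mulr_ge0.
have crec n : (1 <= n <= N)%N ->
    (1 - 2 * kappa * h n) * a n + y n <= a n.-1 + c n.
  move=> nN; apply: le_trans (rec n dl nN dl_gt0) _.
  rewrite /c addrA lerD2l gtr0_norm ?h_gt0// ler_pM2l ?h_gt0// lerD2r.
  by rewrite ler_pM2l// aX//; case/andP: nN.
have := discrete_gronwall c0 crec kN.
have -> : \sum_(1 <= i < N.+1) c i =
    \sum_(1 <= i < N.+1) b i + T * (dl * X k + rho ^+ 2 / dl).
  rewrite big_split/= -mulr_suml -hT; congr (_ + _ * _).
  by apply: eq_big_nat => i iN; rewrite gtr0_norm// h_gt0.
rewrite /dl invrK; set B := \sum_(1 <= i < N.+1) b i => XkB n nN.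
apply: le_trans (Xmax n nN) _.
(* The coefficient of [X k] is 1/2. Moving that half to the left doubles the rest, and twice
   [C * T * (2 * C * T)] is [4 * C ^+ 2 * T ^+ 2]. *)
move: XkB; have -> : C * (B + T * ((2 * C * T)^-1 * X k + rho ^+ 2 * (2 * C * T))) =
    C * B + X k / 2 + 2 * C ^+ 2 * T ^+ 2 * rho ^+ 2.
  by field; rewrite !gt_eqF.
lra.
Qed.

End gronwall.

(** * Independence of the past and the current sample *)

Section independence.
Context d (Om : measurableType d) (R : realType) (P : probability Om R).
Local Open Scope ereal_scope.

(** Dynkin's argument is run twice: for fixed [D] in [G2] the first event is extended to the
    generated sigma-algebra, then that event is fixed and the second one is extended. *)
Lemma pi_system_independence (G1 G2 : set (set Om)) :
  setI_closed G1 -> setI_closed G2 ->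
  G1 `<=` measurable -> G2 `<=` measurable ->
  (forall A B, G1 A -> G2 B -> P (A `&` B) = P A * P B) ->
  forall A B, <<s G1 >> A -> <<s G2 >> B ->
  [/\ measurable A, measurable B & P (A `&` B) = P A * P B].
Proof.
have key (G : set (set Om)) B : setI_closed G -> G `<=` measurable ->
    measurable B -> (forall A, G A -> P (A `&` B) = P A * P B) ->
    forall A, <<s G >> A -> measurable A /\ P (A `&` B) = P A * P B.
  move=> GI Gm mB GB.
  pose D := [set A | measurable A /\ P (A `&` B) = P A * P B].
  have dD : lambda_system setT D.
    apply/dynkin_lambda_system; split => [|A [mA AB]|F tF DF].
    - by split => //; rewrite setTI probability_setT mul1e.
    - split; first exact: measurableC.
      rewrite setIC -setDE measureD//; last first.
        by rewrite ltey_eq fin_num_measure.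
      rewrite (setIC B) [X in _ - X](_ : _ = P A * P B)// probability_setC// muleBl ?mul1e ?fin_num_measure//.
    - have mF n : measurable (F n) by have [] := DF n.
      split; first exact: bigcupT_measurable.
      rewrite setI_bigcupl measure_bigcup//; last 2 first.
        by move=> n _; exact: measurableI.
        exact: trivIset_setIr.
      rewrite measure_bigcup// -[P B]fineK ?fin_num_measure// muleC.
      rewrite -nneseriesZl//; apply: eq_eseriesr => n _.
      by rewrite fineK ?fin_num_measure// muleC; have [] := DF n.
  by move=> A /(lambda_system_subset GI dD); apply => // C GC; split;
    [exact: Gm|exact: GB].
move=> G1I G2I G1m G2m G12 A B GA GB.
have G1B C : <<s G1 >> C -> forall D, G2 D ->
    measurable C /\ P (C `&` D) = P C * P D.
  move=> GC D GD; apply: key GC => //; first exact: G2m.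
  by move=> E GE; exact: G12.
have mA : measurable A.
  by apply: (smallest_sub (@sigma_algebra_measurable _ Om) G1m).
have [mB AB] : measurable B /\ P (B `&` A) = P B * P A.
  apply: key GB => // C GC; rewrite setIC muleC.
  by have [] := G1B _ GA _ GC.
by split => //; rewrite setIC muleC.
Qed.

Lemma negligible_or_conegligible_setI (Z1 Z2 : set Om) :
  P.-negligible Z1 \/ P.-negligible (~` Z1) ->
  P.-negligible Z2 \/ P.-negligible (~` Z2) ->
  P.-negligible (Z1 `&` Z2) \/ P.-negligible (~` (Z1 `&` Z2)).
Proof.
move=> [Z1n|Z1n]; first by left; exact: negligibleS Z1n.
move=> [Z2n|Z2n]; first by left; exact: negligibleS Z2n.
by right; rewrite setCI; exact: negligibleU.
Qed.

Lemma conegligible_measureI (A Z : set Om) : measurable A -> measurable Z ->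
  P.-negligible (~` Z) -> P (A `&` Z) = P A.
Proof.
move=> mA mZ Zn; rewrite [RHS](measureDI P mA mZ) -[LHS]add0e; congr (_ + _).
apply/esym/measure_negligible; first exact: measurableD.
by apply: negligibleS Zn => x [].
Qed.

(** This is why a null or conull factor can be attached to cylinders without spoiling
    independence. *)
Lemma zero_one_measureI (A Z : set Om) : measurable A -> measurable Z ->
  P.-negligible Z \/ P.-negligible (~` Z) -> P (A `&` Z) = P A * P Z.
Proof.
move=> mA mZ [Zn|Zn].
  rewrite (measure_negligible mZ Zn) mule0 measure_negligible//.
    exact: measurableI.
  by apply: negligibleS Zn => x [].
rewrite conegligible_measureI// -[in RHS](setTI Z) conegligible_measureI//.
by rewrite probability_setT mule1.
Qed.

Hypothesis P_complete : measure_is_complete P.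

Lemma conegligible_measurable (Z : set Om) :
  P.-negligible Z \/ P.-negligible (~` Z) -> measurable Z.
Proof.
move=> [/P_complete//|/P_complete mZ].
by rewrite -(setCK Z); exact: measurableC.
Qed.

(** Null and conull sets already form a sigma-algebra: a countable union is conull as soon as one
    member is, and null otherwise. *)
Lemma sigma_null_zero_one (Z : set Om) : sigma_null P Z ->
  P.-negligible Z \/ P.-negligible (~` Z).
Proof.
pose D := [set Z | P.-negligible Z \/ P.-negligible (~` Z)].
have sD : sigma_algebra setT D.
  split => [|A [An|An]|F FD].
  - by left; exact: negligible_set0.
  - by right; rewrite setTD setCK.
  - by left; rewrite setTD.
  - have [[k Fk]|nF] := pselect (exists k, P.-negligible (~` F k)).
      by right; apply: negligibleS Fk; apply: subsetC; exact: bigcup_sup.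
    left; apply: negligible_bigcup => k.
    by case: (FD k) => // Fk; case: nF; exists k.
by apply: (smallest_sub sD) => A An; left.
Qed.

Section cylinders.
Context (dE : nat -> measure_display) (E : forall n, measurableType (dE n)).
Variable xi : forall n, {RV P >-> E n}.

(* The extra factor makes this pi-system generate the null sets as well. *)
Definition cylinder (J : seq nat) : set (set Om) := [set A |
  exists (B : forall n, set (E n)) (Z : set Om),
  [/\ forall n, measurable (B n),
      P.-negligible Z \/ P.-negligible (~` Z) &
      A = (\bigcap_(n in [set` J]) (xi n @^-1` B n)) `&` Z]].

Lemma measurable_cylinder_base (J : seq nat) (B : forall n, set (E n)) :
  (forall n, measurable (B n)) ->
  measurable (\bigcap_(n in [set` J]) (xi n @^-1` B n)).
Proof.
move=> mB; apply: bigcap_measurableType => n _.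
by rewrite -[X in measurable X]setTI; exact: measurable_funP.
Qed.

Lemma cylinder_measurable J : cylinder J `<=` measurable.
Proof.
move=> _ [B [Z [mB Z01 ->]]]; apply: measurableI.
  exact: measurable_cylinder_base.
exact: conegligible_measurable.
Qed.

Lemma cylinder_setI J : setI_closed (cylinder J).
Proof.
move=> _ _ [B1 [Z1 [mB1 Z1n ->]]] [B2 [Z2 [mB2 Z2n ->]]].
exists (fun n => B1 n `&` B2 n), (Z1 `&` Z2); split.
- by move=> n; exact: measurableI.
- exact: negligible_or_conegligible_setI.
- by rewrite setIACA -bigcapI.
Qed.

Hypothesis xi_indep : mutually_independent xi.

Lemma cylinder_independence (J1 J2 : seq nat) (A1 A2 : set Om) :
  uniq (J1 ++ J2) -> (forall n, n \in J1 ++ J2 -> (0 < n)%N) ->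
  cylinder J1 A1 -> cylinder J2 A2 -> P (A1 `&` A2) = P A1 * P A2.
Proof.
move=> uJ J0 [B1 [Z1 [mB1 Z1n ->]]] [B2 [Z2 [mB2 Z2n ->]]].
have mZ1 := conegligible_measurable Z1n.
have mZ2 := conegligible_measurable Z2n.
have mC1 := measurable_cylinder_base J1 mB1.
have mC2 := measurable_cylinder_base J2 mB2.
set C1 := \bigcap_(n in _) _ in mC1 *; set C2 := \bigcap_(n in _) _ in mC2 *.
have [uJ1 dJ uJ2] : [/\ uniq J1, ~~ has (mem J1) J2 & uniq J2].
  by move: uJ; rewrite cat_uniq => /and3P.
have C12 : P (C1 `&` C2) = P C1 * P C2.
  (* The lists are disjoint, so a single family can follow [B1] on [J1] and [B2] on [J2]; mutual
     independence is then used for [J1 ++ J2], [J1] and [J2]. *)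
  pose B n := if n \in J1 then B1 n else B2 n.
  have mB n : measurable (B n) by rewrite /B; case: ifP.
  have BJ1 n : n \in J1 -> B n = B1 n by rewrite /B => ->.
  have BJ2 n : n \in J2 -> B n = B2 n.
    rewrite /B; case: ifPn => // nJ1 nJ2; move/hasPn : dJ => /(_ _ nJ2).
    by rewrite /= nJ1.
  have -> : C1 `&` C2 = \bigcap_(n in [set` J1 ++ J2]) (xi n @^-1` B n).
    apply/seteqP; split=> [w [w1 w2] n /=|w wB].
      rewrite mem_cat => /orP[nJ|nJ]; first by rewrite BJ1//; exact: w1.
      by rewrite BJ2//; exact: w2.
    split=> n /= nJ.
      by rewrite -BJ1//; apply: wB; rewrite /= mem_cat nJ.
    by rewrite -BJ2//; apply: wB; rewrite /= mem_cat nJ orbT.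
  rewrite xi_indep//; last by move=> n nJ; split=> //; exact: J0.
  rewrite big_cat/= /C1 /C2; congr (_ * _).
    rewrite xi_indep//; last first.
      by move=> n nJ; split=> //; apply: J0; rewrite mem_cat nJ.
    by rewrite big_seq [RHS]big_seq; apply: eq_bigr => n /BJ1 ->.
  rewrite xi_indep//; last first.
    by move=> n nJ; split=> //; apply: J0; rewrite mem_cat nJ orbT.
  by rewrite big_seq [RHS]big_seq; apply: eq_bigr => n /BJ2 ->.
rewrite setIACA zero_one_measureI//; last 3 first.
- exact: measurableI.
- exact: measurableI.
- exact: negligible_or_conegligible_setI.
rewrite C12 (zero_one_measureI mZ1 mZ2)// (zero_one_measureI mC1 mZ1)//.
by rewrite (zero_one_measureI mC2 mZ2)// muleACA.
Qed.

Lemma sigma_of_cylinder (J : seq nat) n : n \in J ->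
  sigma_of xi n `<=` cylinder J.
Proof.
move=> nJ _ [B mB <-].
exists (@dfwith nat (fun k => set (E k)) (fun k => setT) n B), setT; split.
- by move=> k; case: dfwithP => //; exact: measurableT.
- by right; rewrite setCT; exact: negligible_set0.
- rewrite setTI setIT; apply/seteqP; split=> [w Bw k _ | w].
    by case: dfwithP.
  by move=> /(_ n nJ); rewrite /= dfwithin.
Qed.

Lemma sigma_null_cylinder (J : seq nat) : sigma_null P `<=` cylinder J.
Proof.
move=> Z /sigma_null_zero_one Zn; exists (fun k => [set: E k]), Z; split => //.
by rewrite (_ : \bigcap_(_ in _) _ = setT) ?setTI//; apply/seteqP; split.
Qed.

Lemma sigma_past_cylinder n :
  sigma_past xi n `<=` <<s cylinder (iota 1 n) >>.
Proof.
apply: smallest_sub; first exact: smallest_sigma_algebra.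
move=> A [|/sigma_null_cylinder cA]; last exact: sub_sigma_algebra.
apply: smallest_sub; first exact: smallest_sigma_algebra.
move=> B [i /= i1n /sigma_of_cylinder cB]; apply: sub_sigma_algebra.
by apply: cB; rewrite mem_iota add1n ltnS.
Qed.

Lemma sigma_xi_cylinder n : sigma_xi xi n `<=` <<s cylinder [:: n] >>.
Proof.
apply: smallest_sub; first exact: smallest_sigma_algebra.
move=> A [/sigma_of_cylinder cA|/sigma_null_cylinder cA];
  apply: sub_sigma_algebra; last exact: cA.
by apply: cA; rewrite mem_head.
Qed.

(** The past lies in the sigma-algebra of cylinders over [1, ..., n] and the current sample in that
    over [n.+1]; the two index lists are disjoint and avoid index 0. Completeness of [P] gives the
    measurability of both events. *)
Lemma sigma_past_xi_independence n (A B : set Om) :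
  sigma_past xi n A -> sigma_xi xi n.+1 B ->
  [/\ measurable A, measurable B & P (A `&` B) = P A * P B].
Proof.
move=> /sigma_past_cylinder cA /sigma_xi_cylinder cB.
apply: pi_system_independence cA cB; try exact: cylinder_setI;
  try exact: cylinder_measurable.
move=> C D; apply: cylinder_independence.
  by rewrite -[X in _ ++ [:: X]]add1n -[[:: _]]/(iota (1 + n) 1) -iotaD iota_uniq.
by move=> k; rewrite mem_cat mem_iota inE => /orP[/andP[]//|/eqP ->].
Qed.

Lemma sigma_past_measurable n : sigma_past xi n `<=` measurable.
Proof.
(* Independence is invoked against the empty event for the sake of its measurability clause. *)
have s0 : sigma_xi xi n.+1 set0.
  exact: sigma_algebra0.
by move=> A /sigma_past_xi_independence => /(_ _ s0)[].
Qed.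

Lemma sigma_xi_measurable n : (0 < n)%N -> sigma_xi xi n `<=` measurable.
Proof.
case: n => // n _.
have s0 : sigma_past xi n set0.
  exact: sigma_algebra0.
by move=> A /(sigma_past_xi_independence s0)[].
Qed.

End cylinders.

(** Integrating over [A] is integrating against [P] restricted to [A], and independence says that
    the image of this measure under [phi] is [P A] times the law of [phi]. *)
Lemma ge0_integral_independence (phi : Om -> R) (A : set Om) (psi : R -> \bar R) :
  measurable A -> measurable_fun [set: Om] phi ->
  (forall Y, measurable Y ->
    P (A `&` phi @^-1` Y) = P A * P (phi @^-1` Y)) ->
  measurable_fun [set: R] psi -> (forall r, 0 <= psi r) ->
  \int[P]_(w in A) psi (phi w) = P A * \int[P]_w psi (phi w).
Proof.
move=> mA mphi indep mpsi psi0; pose m := mrestr P mA.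
have mpp : measurable_fun [set: Om] (psi \o phi) by exact: measurableT_comp.
have -> : \int[P]_(w in A) psi (phi w) = \int[m]_w psi (phi w).
  rewrite (@ge0_negligible_integral _ _ _ m setT (~` A))//; last 2 first.
    exact: measurableC.
    by rewrite /m/= /mrestr setICl measure0.
  rewrite setTD setCK; apply: eq_measure_integral => B mB BA.
  by rewrite /m/= /mrestr (setIidl BA).
have -> : \int[m]_w psi (phi w) = \int[pushforward m phi]_r psi r.
  by rewrite ge0_integral_pushforward.
have -> : \int[P]_w psi (phi w) = \int[pushforward P phi]_r psi r.
  by rewrite ge0_integral_pushforward.
have PA0 : (0 <= fine (P A))%R by rewrite fine_ge0.
rewrite -[P A]fineK ?fin_num_measure//.
rewrite -[fine (P A)]/((NngNum PA0)%:num) -ge0_integral_mscale//.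
apply: eq_measure_integral => Y mY _.
rewrite /= /mscale/= /pushforward /m /mrestr setIC indep//.
by rewrite fineK ?fin_num_measure.
Qed.

(** The nonnegative case applies to the positive and the negative part, and the finite factor [P A]
    distributes over their difference. *)
Lemma integral_independence0 (phi : Om -> R) (A : set Om) :
  measurable A -> P.-integrable [set: Om] (EFin \o phi) ->
  (forall Y, measurable Y ->
    P (A `&` phi @^-1` Y) = P A * P (phi @^-1` Y)) ->
  \int[P]_w (phi w)%:E = 0 -> \int[P]_(w in A) (phi w)%:E = 0.
Proof.
move=> mA iphi indep phi0.
have mphi : measurable_fun [set: Om] phi.
  by apply/measurable_EFinP; exact: measurable_int iphi.
have pE (f : \bar R -> \bar R) : measurable_fun setT f ->
    (forall x, 0 <= f x) ->
    \int[P]_(w in A) f (phi w)%:E = P A * \int[P]_w f (phi w)%:E.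
  move=> mf f0; apply: (ge0_integral_independence (psi := f \o EFin)) => //.
    exact: measurableT_comp.
  by move=> r; exact: f0.
suff -> : \int[P]_(w in A) (phi w)%:E = P A * \int[P]_w (phi w)%:E.
  by rewrite phi0 mule0.
rewrite integralE [in RHS]integralE muleBr ?fin_num_measure//; last first.
    rewrite fin_num_adde_defl// fin_numN.
    exact: integrable_neg_fin_num.
congr (_ - _).
  have /pE : measurable_fun setT (fun x : \bar R => maxe x 0).
    exact: measurable_maxe.
  by rewrite funepos.unlock; apply => x; rewrite le_max lexx orbT.
have /pE : measurable_fun setT (fun x : \bar R => maxe (- x) 0).
  by apply: measurable_maxe => //; exact: measurable_funeN.
by rewrite funeneg.unlock; apply => x; rewrite le_max lexx orbT.
Qed.

End independence.

(** * Hilbert space valued random variables *)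

Lemma sigma_algebra_setT (S : Type) (F : set (set S)) :
  sigma_algebra [set: S] F -> F setT.
Proof. by move=> [F0 FC _]; rewrite -(setD0 setT); exact: FC. Qed.

Lemma sigma_algebra_setU (S : Type) (F : set (set S)) (A B : set S) :
  sigma_algebra [set: S] F -> F A -> F B -> F (A `|` B).
Proof.
move=> [F0 _ FU] FA FB; rewrite -bigcup2E; apply: FU => -[|[|n]] //=.
Qed.

Lemma sigma_algebra_setD (S : Type) (F : set (set S)) (A B : set S) :
  sigma_algebra [set: S] F -> F A -> F B -> F (A `\` B).
Proof.
move=> sF FA FB; have [_ FC _] := sF.
rewrite setDE -(setCK (_ `&` _)) setCI setCK -setTD; apply: (FC).
by apply: sigma_algebra_setU => //; rewrite -setTD; exact: (FC).
Qed.

(** The sets whose preimage lies in [F] form a sigma-algebra, so open intervals suffice. [F] is a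
    bare family of sets here in order to cover the past and the current sample. *)
Lemma measurable_wrt_comp (R : realType) (S : Type) (X : topologicalType)
    (F : set (set S)) (f : S -> X) (g : X -> R) (Y : set R) :
  sigma_algebra [set: S] F -> measurable_wrt F [set: S] f -> continuous g ->
  measurable Y -> F ((fun w => g (f w)) @^-1` Y).
Proof.
move=> [F0 FC FU] mf cg mY; pose D := [set Y | F ((fun w => g (f w)) @^-1` Y)].
have sD : sigma_algebra [set: R] D.
  split=> [|A DA|A DA]; first by rewrite /D/= preimage_set0.
    by rewrite /D/= setTD preimage_setC -setTD; exact: FC.
  by rewrite /D/= preimage_bigcup; exact: FU.
have : (@ocitv R).-sigma.-measurable Y by exact: mY.
rewrite RGenOpens.measurableE; apply: (smallest_sub sD).
move=> _ [x [y ->]]; rewrite /D/= -[X in F X]setTI.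
apply: (mf (g @^-1` `]x, y[)); apply: open_comp => //.
Qed.

(** * Measurability under changes on null sets *)

Section negligible_modification.
Context d (S : measurableType d) (R : realType).
Variables (mu : {measure set S -> \bar R}) (F : set (set S)).
Hypothesis sF : sigma_algebra [set: S] F.
Hypothesis Fnull : mu.-negligible `<=` F.

Lemma ae_eq_sigma_algebra (A B : set S) :
  {ae mu, forall w, A w <-> B w} -> F A -> F B.
Proof.
move=> AB FA.
have nAB : mu.-negligible (A `\` B).
  by apply: negligibleS AB => w [Aw Bw] /= AB; apply: Bw; exact/AB.
have nBA : mu.-negligible (B `\` A).
  by apply: negligibleS AB => w [Bw Aw] /= AB; apply: Aw; exact/AB.
have -> : B = (A `\` (A `\` B)) `|` (B `\` A).
  by rewrite setDD setIC setUIDK.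
apply: sigma_algebra_setU => //; last exact: Fnull.
by apply: sigma_algebra_setD => //; exact: Fnull.
Qed.

Lemma ae_eq_preimage (X : Type) (f g : S -> X) (Y : set X) :
  {ae mu, forall w, f w = g w} -> F (f @^-1` Y) -> F (g @^-1` Y).
Proof. by move=> fg; apply: ae_eq_sigma_algebra;
  apply: filterS fg => w /= ->. Qed.

Lemma ae_eq_measurable_wrt (X : topologicalType) (f g : S -> X) :
  {ae mu, forall w, f w = g w} ->
  measurable_wrt F [set: S] f -> measurable_wrt F [set: S] g.
Proof.
by move=> fg mf O oO; rewrite setTI; apply: ae_eq_preimage fg _;
  rewrite -[X in F X]setTI; exact: mf.
Qed.

End negligible_modification.

Lemma dense_range_sequence (R : realType) (V H : normedModType R) (g : V -> H) :
  separable V -> continuous g -> dense (range g) ->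
  exists x : nat -> V, dense (range (g \o x)).
Proof.
move=> [A /countable_injP[c cinj] dA] cg dg.
(* The injection [c] numbers the points of [A]; an index that is no number yields 0, which cannot
   harm density. *)
exists (fun k => xget 0 [set a | A a /\ c a = k]) => O [y Oy] oO.
have [_ [/[swap] [[v _ <-]] Og]] := dg O (ex_intro _ y Oy) oO.
have [a [Oa Aa]] : (g @^-1` O) `&` A !=set0.
  apply: dA; first by exists v.
  by apply: open_comp => // z _; exact: cg.
exists (g a); split => //; exists (c a) => //=; congr g.
by case: xgetP => [b _ [Ab cb]|/(_ a)[]//]; apply: cinj; rewrite ?inE.
Qed.

Section dense_sequence.
Context (R : realType) (H : normedModType R) (x : nat -> H).
Hypothesis dx : dense (range x).

Lemma dense_sequence_near (y : H) (eps : R) : 0 < eps ->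
  exists k, `|y - x k| < eps.
Proof.
move=> e0; have [z [yz [k _ kz]]] : ball y eps `&` range x !=set0.
  apply: dx; first by exists y; exact: ballxx.
  exact: ball_open.
by exists k; rewrite kz; move: yz; rewrite -ball_normE.
Qed.

(** An [x k] close to [b] comes within twice its distance to [b] of the value [|a - b|]. The formula
    involves countably many distances to fixed points, so it gives measurability of [|X - Y|]
    without a Borel structure on pairs. *)
Lemma norm_sub_sups (a b : H) :
  `|a - b| = sups (fun k => `| `|a - x k| - `|b - x k| |) 0%N.
Proof.
have ub k : `| `|a - x k| - `|b - x k| | <= `|a - b|.
  by rewrite (le_trans (ler_dist_dist _ _))// opprB addrA subrK.
have hub : has_ubound [set `| `|a - x k| - `|b - x k| | | k in [set k | 0 <= k]%N].
  by exists `|a - b| => _ [k _ <-]; exact: ub.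
apply/eqP; rewrite eq_le; apply/andP; split; last first.
  by apply: ge_sup => [|_ [k _ <-]];
    [exists `| `|a - x 0%N| - `|b - x 0%N| |, 0%N|exact: ub].
apply/ler_addgt0Pr => e e0.
have [k bk] := dense_sequence_near b (divr_gt0 e0 (@ltr0Sn R 1)).
have : `| `|a - x k| - `|b - x k| | <= sups (fun k => `| `|a - x k| - `|b - x k| |) 0%N.
  by apply: ub_le_sup => //; exists k.
have : `|a - b| <= `|a - x k| + `|b - x k| by rewrite (distrC b);
  exact: ler_distD.
have := ler_norm (`|a - x k| - `|b - x k|).
move: bk; lra.
Qed.

Context d (S : measurableType d).

Lemma measurable_norm_comp (X : S -> H) (c : H) :
  measurable_wrt measurable [set: S] X ->
  measurable_fun [set: S] (fun w => `|X w - c|).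
Proof.
move=> mX _ Y mY; rewrite setTI.
apply: (measurable_wrt_comp (g := fun y => `|y - c|)) mX _ mY.
  exact: sigma_algebra_measurable.
by move=> y; apply: cvg_norm; apply: cvgB; [exact: cvg_id|exact: cvg_cst].
Qed.

Lemma measurable_norm_sub (X Y : S -> H) :
  measurable_wrt measurable [set: S] X -> measurable_wrt measurable [set: S] Y ->
  measurable_fun [set: S] (fun w => `|X w - Y w|).
Proof.
move=> mX mY.
have -> : (fun w => `|X w - Y w|) =
    (fun w => sups (fun k => `| `|X w - x k| - `|Y w - x k| |) 0%N).
  by apply/funext => w; exact: norm_sub_sups.
apply: measurable_fun_sups => [w _|k].
  exists `|X w - Y w| => _ [k _ <-].
  by rewrite (le_trans (ler_dist_dist _ _))// opprB addrA subrK.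
apply: measurableT_comp => //; apply: measurable_funB;
  exact: measurable_norm_comp.
Qed.

End dense_sequence.

(** * Continuous functionals of Bochner integrable maps *)

Section bochner_functional.
Context d (S : measurableType d) (R : realType) (P : probability S R).
Context (B : normedModType R) (L : {linear B -> R}).
Hypothesis L_continuous : continuous L.

Lemma continuous_functional_bound :
  exists2 M : R, 0 < M & forall b, `|L b| <= M * `|b|.
Proof.
have /linear_boundedP/pinfty_ex_gt0[M M0 LM] :
    bounded_near (L : {linear B -> R}) (nbhs (0 : B)).
  exact/linear_bounded_continuous.
by exists M.
Qed.

Local Open Scope ereal_scope.

Lemma integral_simple_fun (l : seq (set S * B)) :
  (forall a, a \in l -> measurable a.1) ->
  P.-integrable [set: S] (fun w => (L (simple_fun l w))%:E) /\
  \int[P]_w (L (simple_fun l w))%:E = (L (simple_mean P l))%:E.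
Proof.
have LZ r (b : B) : (L (r *: b) = r * L b)%R by exact: linearZ.
elim: l => [|a l IH] ml.
  rewrite /simple_mean big_nil linear0.
  have e : (fun w : S => (L (simple_fun [::] w))%:E) = cst 0.
    by apply/funext => w; rewrite /simple_fun big_nil linear0.
  by split; [rewrite e; exact: integrable0|rewrite e integral0].
have ma : measurable a.1 by apply: ml; rewrite mem_head.
have [il El] : P.-integrable [set: S] (fun w => (L (simple_fun l w))%:E) /\
    \int[P]_w (L (simple_fun l w))%:E = (L (simple_mean P l))%:E.
  by apply: IH => b bl; apply: ml; rewrite in_cons bl orbT.
have E w : (L (simple_fun (a :: l) w))%:E =
    (L a.2)%:E * (\1_(a.1) w)%:E + (L (simple_fun l w))%:E.
  by rewrite /simple_fun big_cons linearD LZ mulrC.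
have i1 : P.-integrable [set: S] (fun w => (\1_(a.1) w)%:E).
  exact: integrable_indic.
have ia : P.-integrable [set: S] (fun w => (L a.2)%:E * (\1_(a.1) w)%:E).
  exact: integrableZl.
split.
  by under eq_fun do rewrite E; exact: integrableD.
under eq_integral do rewrite E.
rewrite integralD//= El integralZl// integral_indic// setIT.
rewrite /simple_mean big_cons linearD LZ EFinD EFinM muleC.
by rewrite fineK// fin_num_measure.
Qed.

(** A bound [M] of [L] turns L^1 approximation of [X] by simple maps into L^1 approximation of
    [L X], while the simple means are mapped to a sequence tending to [L m]. *)
Lemma has_expectation_functional (X : S -> B) (m : B) :
  has_expectation P X m ->
  P.-integrable [set: S] (fun w => (L (X w))%:E) /\
  \int[P]_w (L (X w))%:E = (L m)%:E.
Proof.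
move=> [mX [l [ml Xl lm]]].
have [M M0 LM] := continuous_functional_bound.
have mLX : measurable_fun [set: S] (fun w => L (X w)).
  move=> _ Y mY; rewrite setTI.
  exact: (measurable_wrt_comp (@sigma_algebra_measurable _ S) mX).
have is_ k := (integral_simple_fun (ml k)).1.
have Es k := (integral_simple_fun (ml k)).2.
have mLs k : measurable_fun [set: S] (fun w => L (simple_fun (l k) w)).
  by apply/measurable_EFinP; exact: measurable_int (is_ k).
pose D k w := (L (X w) - L (simple_fun (l k) w))%R.
have mD k : measurable_fun [set: S] (D k) by exact: measurable_funB.
have DM k : \int[P]_w (`|D k w|)%:E <=
    M%:E * \int[P]_w (`|X w - simple_fun (l k) w|)%:E.
  (* The constant is pulled through the integral on the side of [D k], the one known to be
     measurable. *)
  rewrite -[leLHS]mul1e -(@mulfV _ M) ?gt_eqF// EFinM -muleA.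
  rewrite lee_pmul2l// -ge0_integralZl//; last 2 first.
  - by apply/measurable_EFinP; exact: measurableT_comp.
  - by rewrite lee_fin invr_ge0 ltW.
  apply: ge0_le_integral_nonmeasurable => w.
    by rewrite mule_ge0// lee_fin// invr_ge0 ltW.
  by rewrite -EFinM lee_fin ler_pdivrMl// /D -linearB.
have small (e : R) : (0 < e)%R -> \forall k \near \oo,
    \int[P]_w (`|D k w|)%:E < e%:E.
  move=> e0.
  have : \forall k \near \oo,
      \int[P]_w (`|X w - simple_fun (l k) w|)%:E < (e / M)%:E.
    have U : nbhs (0 : \bar R) [set y | y < (e / M)%:E].
      apply: open_nbhs_nbhs; split; first exact: open_ereal_lt_ereal.
      by rewrite /= lte_fin divr_gt0.
    exact: Xl U.
  apply: filterS => k kM; apply: le_lt_trans (DM k) _.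
  by rewrite -lte_pdivlMl// -EFinM mulrC.
have iLX : P.-integrable [set: S] (fun w => (L (X w))%:E).
  have [k kD] := filter_ex (small 1%R ltr01).
  have iD : P.-integrable [set: S] (EFin \o D k).
    apply/integrableP; split; first exact/measurable_EFinP.
    by apply: lt_trans kD _; exact: ltry.
  apply: (eq_integrable _ (fun w => (D k w)%:E + (L (simple_fun (l k) w))%:E)) => //.
    by move=> w _; rewrite -EFinD subrK.
  exact: integrableD.
split => //.
have fI : \int[P]_w (L (X w))%:E \is a fin_num by exact: integrable_fin_num.
rewrite -(fineK fI); congr EFin; set I := fine _.
have Ik k : (`|I - L (simple_mean P (l k))|%:E <= \int[P]_w (`|D k w|)%:E).
  rewrite -abse_EFin EFinB /I fineK// -Es -integralB//.
  apply: le_trans (le_abse_integral _ _ _) _ => //.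
  by apply/measurable_EFinP; exact: (mD k).
have Lm : (fun k => L (simple_mean P (l k))) @ \oo --> L m.
  by apply: cvg_comp lm _; exact: L_continuous.
apply/eqP; rewrite -subr_eq0 -normr_le0; apply/ler_addgt0Pr => e e0.
have e2 : (0 < e / 2)%R by rewrite divr_gt0.
move/cvgrPdist_lt : Lm => /(_ _ e2) Lm.
have [k [k1 k2]] := filter_ex (filterI (small _ e2) Lm).
rewrite add0r (le_trans (ler_distD (L (simple_mean P (l k))) _ _))//.
rewrite [leRHS]splitr lerD//; last by rewrite distrC ltW.
by rewrite -lee_fin (le_trans (Ik k))// ltW.
Qed.

End bochner_functional.
Section hilbert_random.
Context (R : realType) (H : hilbertType R).
Context d (Om : measurableType d) (P : probability Om R).
Local Open Scope ereal_scope.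

Lemma hdot_linear_left (y : H) : linear (hdot^~ y : H -> R).
Proof. by move=> a b c; exact: hdotPl. Qed.

Definition hdot_left (y : H) : {linear H -> R} := HB.pack (hdot^~ y : H -> R)
  (GRing.isLinear.Build R H R *:%R _ (hdot_linear_left y)).

Lemma hdot_continuous (y : H) : continuous (hdot^~ y : H -> R).
Proof.
suff : bounded_near (hdot_left y) (nbhs (0 : H)%R).
  by move/linear_bounded_continuous.
apply/linear_boundedP; near=> r => z.
rewrite (le_trans (hdot_le_norm _ _))// mulrC ler_wpM2r//.
Unshelve. all: by end_near. Qed.

Lemma hdotNl (a b : H) : hdot (- a)%R b = (- hdot a b)%R.
Proof.
have := hdotPr (-1) a 0%R b.
by rewrite scaleN1r addr0 mulN1r hdot0r addr0 !(hdotC b).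
Qed.

Lemma hdotDl (a b c : H) : hdot (a + b)%R c = (hdot a c + hdot b c)%R.
Proof. by have := hdotPl 1 a b c; rewrite scale1r mul1r. Qed.

Lemma hdotBl (a b c : H) : hdot (a - b)%R c = (hdot a c - hdot b c)%R.
Proof. by rewrite hdotDl hdotNl. Qed.

Lemma hdotDr (a b c : H) : hdot c (a + b)%R = (hdot c a + hdot c b)%R.
Proof. by rewrite !(hdotC c) hdotDl. Qed.

Lemma hdotBr (a b c : H) : hdot c (a - b)%R = (hdot c a - hdot c b)%R.
Proof. by rewrite !(hdotC c) hdotBl. Qed.

Lemma normB_sq (a b : H) :
  (`|a - b| ^+ 2 = `|a| ^+ 2 - 2 * hdot a b + `|b| ^+ 2)%R.
Proof.
by rewrite -!hdot_norm hdotBl !hdotBr (hdotC b a); ring.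
Qed.

Lemma normD_sq (a b : H) :
  (`|a + b| ^+ 2 = `|a| ^+ 2 + 2 * hdot a b + `|b| ^+ 2)%R.
Proof. by rewrite -!hdot_norm hdotDl !hdotDr (hdotC b a); ring. Qed.

Lemma normD_sq_le (a b : H) : (`|a + b| ^+ 2 <= 2 * `|a| ^+ 2 + 2 * `|b| ^+ 2)%R.
Proof. by have := sqr_ge0 (`|a - b|)%R; rewrite normB_sq normD_sq; lra. Qed.

Section measurability.
Variable x : nat -> H.
Hypothesis dx : dense (range x).

(** Polarization reduces the product to norms of [X], [Y] and [X - Y]. *)
Lemma measurable_hdot (X Y : Om -> H) :
  measurable_wrt measurable [set: Om] X -> measurable_wrt measurable [set: Om] Y ->
  measurable_fun [set: Om] (fun w => hdot (X w) (Y w)).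
Proof.
move=> mX mY.
have -> : (fun w => hdot (X w) (Y w)) = (fun w => 2^-1 *
    (`|X w - 0| ^+ 2 + `|Y w - 0| ^+ 2 - `|X w - Y w| ^+ 2))%R.
  by apply/funext => w; rewrite !subr0 normB_sq; field.
apply: measurable_funM => //; apply: measurable_funB.
  by apply: measurable_funD; apply: measurable_funX;
    exact: measurable_norm_comp.
by apply: measurable_funX; exact: (measurable_norm_sub dx).
Qed.

(* On the cell where [x k] is the first point within [eps] of [Y], replacing [Y]
   by [x k] kills the integral and costs at most [eps * `|g|]. *)
Lemma integral_hdot_le (F : set (set Om)) (g Y : Om -> H) (eps : R) :
  sigma_algebra setT F -> F `<=` measurable ->
  measurable_wrt F [set: Om] Y ->
  P.-integrable [set: Om] (fun w => (`|g w|)%:E) ->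
  (forall k, P.-integrable [set: Om] (fun w => (hdot (g w) (x k))%:E)) ->
  (forall k A, F A -> \int[P]_(w in A) (hdot (g w) (x k))%:E = 0) ->
  P.-integrable [set: Om] (fun w => (hdot (g w) (Y w))%:E) ->
  (0 < eps)%R ->
  \int[P]_w (hdot (g w) (Y w))%:E <= eps%:E * \int[P]_w (`|g w|)%:E.
Proof.
move=> sF Fm mY ig igx gx0 igY e0.
pose A k := [set w | (`|Y w - x k| < eps)%R].
have FA k : F (A k).
  have : open [set y : H | (`|y - x k| < eps)%R].
    have -> : [set y : H | (`|y - x k| < eps)%R] = ball (x k) eps.
      by apply/seteqP; split=> y /=; rewrite -ball_normE/= distrC.
    exact: ball_open.
  by move/mY; rewrite setTI.
have FD k : F (seqDU A k).
  rewrite /seqDU; apply: sigma_algebra_setD => //.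
  rewrite -bigcup_mkord; have [F0 _ FU] := sF.
  rewrite bigcup_mkcond; apply: FU => n.
  by case: ifP.
have UA : \bigcup_k seqDU A k = setT.
  rewrite -seqDU_bigcup_eq; apply/seteqP; split=> // w _.
  by have [k Yk] := dense_sequence_near dx (Y w) e0; exists k.
pose psi w := (eps * `|g w| - hdot (g w) (Y w))%R.
have ieg : P.-integrable [set: Om] (fun w => eps%:E * (`|g w|)%:E).
  exact: integrableZl.
have ipsi : P.-integrable [set: Om] (fun w => (psi w)%:E).
  by under eq_fun do rewrite /psi EFinB EFinM; exact: integrableB.
have psi0 : 0 <= \int[P]_w (psi w)%:E.
  rewrite -UA integral_bigcup//; last 2 first.
  - by move=> k; exact/Fm.
  - by rewrite UA.
  apply: nneseries_ge0 => k _ _.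
  have mk : measurable (seqDU A k) by exact/Fm.
  (* Adding the vanishing integral of [(g, x k)] turns the integrand into
     [eps * |g| - (g, Y - x k)], which is nonnegative on the cell. *)
  rewrite -[leRHS]adde0 -[X in _ + X](gx0 k _ (FD k)) -integralD//;
    last 2 first.
  - exact: (integrableS measurableT).
  - exact: (integrableS measurableT).
  apply: integral_ge0 => w [Akw _]; rewrite -EFinD lee_fin /psi.
  have : (hdot (g w) (Y w - x k) <= `|g w| * eps)%R.
    apply: le_trans (ler_norm _) _; apply: le_trans (hdot_le_norm _ _) _.
    by rewrite ler_wpM2l// ltW.
  rewrite hdotBr; lra.
move: psi0; under eq_integral do rewrite /psi EFinB EFinM.
rewrite integralB// integralZl// sube_ge0//.
by rewrite integrable_fin_num// orbT.
Qed.

(** The one-sided bound is applied to [g] and to [- g] with arbitrarily small [eps]. Orthogonality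
    is asked only against the fixed vectors [x k] on events of [F], which is all that the data
    provide. *)
Lemma integral_hdot_eq0 (F : set (set Om)) (g Y : Om -> H) :
  sigma_algebra setT F -> F `<=` measurable ->
  measurable_wrt F [set: Om] Y ->
  P.-integrable [set: Om] (fun w => (`|g w|)%:E) ->
  (forall k, P.-integrable [set: Om] (fun w => (hdot (g w) (x k))%:E)) ->
  (forall k A, F A -> \int[P]_(w in A) (hdot (g w) (x k))%:E = 0) ->
  P.-integrable [set: Om] (fun w => (hdot (g w) (Y w))%:E) ->
  \int[P]_w (hdot (g w) (Y w))%:E = 0.
Proof.
move=> sF Fm mY ig igx gx0 igY.
have fgY : \int[P]_w (hdot (g w) (Y w))%:E \is a fin_num.
  exact: integrable_fin_num.
have fg : \int[P]_w (`|g w|)%:E \is a fin_num by exact: integrable_fin_num.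
have igN k : P.-integrable [set: Om] (fun w => (hdot (- g w) (x k))%:E).
  by under eq_fun do rewrite hdotNl EFinN; exact: integrableN.
have igYN : P.-integrable [set: Om] (fun w => (hdot (- g w) (Y w))%:E).
  by under eq_fun do rewrite hdotNl EFinN; exact: integrableN.
have gN0 k A : F A -> \int[P]_(w in A) (hdot (- g w) (x k))%:E = 0.
  move=> FA; under eq_integral do rewrite hdotNl EFinN.
  rewrite integralN ?gx0 ?oppe0//.
  have iA : P.-integrable A (fun w => (hdot (g w) (x k))%:E).
    by apply: (integrableS measurableT) => //; exact: Fm.
  by apply: integrable_add_def iA; exact: Fm.
have ignN : P.-integrable [set: Om] (fun w => (`|- g w|)%:E).
  by under eq_fun do rewrite normrN.
apply/eqP; rewrite -(fineK fgY) eqe -normr_le0; apply/ler_addgt0Pr => e e0.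
set I := fine _; set G := fine (\int[P]_w (`|g w|)%:E).
have G0 : (0 <= G)%R by rewrite fine_ge0// integral_ge0.
pose eps := (e / (G + 1))%R.
have eps0 : (0 < eps)%R by rewrite divr_gt0// ltr_wpDl.
have epsG : (eps * G <= e)%R.
  by rewrite /eps mulrAC ler_pdivrMr ?ltr_wpDl// ler_pM2l// lerDl.
rewrite add0r; apply: le_trans epsG.
rewrite ler_norml; apply/andP; split.
  rewrite lerNl -lee_fin EFinN EFinM /I /G !fineK//.
  have := integral_hdot_le sF Fm mY ignN igN gN0 igYN eps0.
  under eq_integral do rewrite hdotNl EFinN.
  under [in leRHS]eq_integral do rewrite normrN.
  by rewrite integralN//; exact: integrable_add_def.
by rewrite -lee_fin EFinM /I /G !fineK//;
  exact: integral_hdot_le sF Fm mY _ _ _ _ _.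
Qed.

End measurability.
End hilbert_random.

(** * Energy estimate of one step and consistency error *)

Section embedded_banach_theory.
Context (R : realType) (H : hilbertType R).
Implicit Types V W : embedded_banach H.

Lemma dense_emb_near V (y : H) (eps : R) : 0 < eps ->
  exists v : V, `|y - emb V v| < eps.
Proof.
move=> e0; have [_ [/[swap] [[v _ <-]] yz]] : ball y eps `&` range (emb V) !=set0.
  apply: (@emb_dense _ _ V); first by exists y; exact: ballxx.
  exact: ball_open.
by exists v; move: yz; rewrite -ball_normE.
Qed.

(** One would test with [h] itself, but it need not lie in [V]; a vector of [V] within [eps] of it
    gives [|h| ^+ 2 <= M * |h| + eps * (|h| + M)]. *)
Lemma norm_le_hdot_emb V (h : H) (M : R) : 0 <= M ->
  (forall v : V, hdot h (emb V v) <= M * `|emb V v|) -> `|h| <= M.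
Proof.
move=> M0 hM; have h0 := normr_ge0 h.
have : `|h| ^+ 2 <= M * `|h|.
  apply/ler_addgt0Pr => e e0.
  pose eps := e / (`|h| + M + 1).
  have p0 : 0 < `|h| + M + 1 by rewrite ltr_wpDl// addr_ge0.
  have eps0 : 0 < eps by rewrite divr_gt0.
  have [v hv] := dense_emb_near V h eps0.
  have epsE : eps * (`|h| + M) <= e.
    by rewrite /eps mulrAC ler_pdivrMr// ler_pM2l// lerDl.
  have vh : `|emb V v| <= `|h| + eps.
    rewrite -[emb V v](subrK h) addrC (le_trans (ler_normD _ _))// lerD2l.
    by rewrite distrC ltW.
  have h1 : hdot h (h - emb V v) <= `|h| * eps.
    apply: le_trans (ler_norm _) _; apply: le_trans (hdot_le_norm _ _) _.
    by rewrite ler_wpM2l// ltW.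
  rewrite -hdot_norm -[X in hdot h X](subrK (emb V v)) hdotDr.
  have := hM v; nra.
rewrite expr2; have [->//|hn0] := eqVneq `|h| 0.
by rewrite ler_pM2r// lt0r hn0.
Qed.

Lemma to_dual_inj V : injective (@to_dual R H V).
Proof.
move=> h1 h2 h12; apply/eqP; rewrite -subr_eq0 -normr_le0.
apply: (norm_le_hdot_emb (V := V)) => // v; rewrite mul0r hdotBl subr_le0.
have : to_dual V h1 v = to_dual V h2 v by rewrite h12.
by move=> /= ->.
Qed.

Lemma to_dualB V (h1 h2 : H) : to_dual V (h1 - h2) = to_dual V h1 - to_dual V h2.
Proof. by apply: val_inj; apply/funext => v /=; exact: hdotBl. Qed.

Lemma to_dualK V : cancel (to_dual V) (@to_H R H V).
Proof.
move=> h; rewrite /to_H; case: xgetP => [g _ /= /to_dual_inj//|/(_ h)].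
by case.
Qed.

Lemma vliftK V : cancel (emb V) (vlift V).
Proof.
move=> v; rewrite /vlift; case: xgetP => [w _ /= /emb_inj//|/(_ v)].
by case.
Qed.

(** Measurability and mean of A_xi u, stated in the dual of [V], can thereby be read off its
    representative in [H]. *)
Lemma restrict_dual_to_dual V W (h : H) : densely_embeds V W ->
  restrict_dual V (to_dual W h) = to_dual V h.
Proof.
move=> [j [_ _ jE]].
have hE v : to_dual V h v = to_dual W h (vlift W (emb V v)).
  by rewrite -jE vliftK /= jE.
rewrite /restrict_dual; case: xgetP => [psi _ /= psiE|/(_ (to_dual V h))[]//].
by apply: val_inj; apply/funext => v; rewrite /= psiE -[LHS]hE.
Qed.

Lemma scheme_energy V W (T p kappa kx eta beta mu lambda s hn : R)
    (B : R -> W -> dual W) (un um v vm fn du : H) :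
  densely_embeds V W -> condition_A T p B kx eta beta mu lambda ->
  kx <= kappa -> 0 <= s <= T -> 0 < hn -> range (emb V) v ->
  range (to_dual W) (B s (vlift W v)) -> range (emb W) un ->
  to_dual W (un - um) + hn *: B s (vlift W un) = hn *: to_dual W fn ->
  let g := fn - to_H (B s (vlift W v)) - du in
  (1 - 2 * kappa * hn) * `|un - v| ^+ 2 + 2^-1 * `|(un - v) - (um - vm)| ^+ 2 +
    2 * hn * (eta * semi (vlift W (un - v)) `^ p) <=
  `|um - vm| ^+ 2 + 2 * hn ^+ 2 * `|g| ^+ 2 + 2 * hn * hdot g (um - vm) +
    2 * `|hn *: du - (v - vm)| * `|un - v|.
Proof.
move=> [j [_ _ jE]] cB kk sT hn0 [y _ <-] + [z _ <-].
rewrite -jE !vliftK => -[a _ aE]; rewrite -aE to_dualK => eqn.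
have -> : vlift W (emb W z - emb W (j y)) = z - j y.
  by rewrite -raddfB vliftK.
set e := emb W z - emb W (j y); set ep := um - vm.
pose g := fn - a - du; rewrite /= -/g; set r := hn *: du - _.
have eE : emb W (z - j y) = e by rewrite raddfB.
have := congr1 (fun phi : dual W => phi (z - j y)) eqn.
have -> : (to_dual W (emb W z - um) + hn *: B s z) (z - j y) =
  hdot (emb W z - um) (emb W (z - j y)) + hn * B s z (z - j y) by [].
have -> : (hn *: to_dual W fn) (z - j y) = hn * hdot fn (emb W (z - j y)) by [].
have := condA_monotone cB z (j y) sT.
have -> : (B s z - B s (j y)) (z - j y) =
    B s z (z - j y) - hdot a (emb W (z - j y)).
  by rewrite -aE.
rewrite eE; set q := semi _ `^ p => mono test.
have ee : hdot e e = `|e| ^+ 2 by exact: hdot_norm.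
have eL : hdot e e = hdot (emb W z) e - hdot (emb W (j y)) e.
  by rewrite {1}/e hdotBl.
(* The increment of the scheme is [e - ep] plus the increment of the exact solution, and the latter
   is [hn *: du - r]. *)
have zL : hdot (emb W z - um) e =
    `|e| ^+ 2 - hdot ep e + hn * hdot du e - hdot r e.
  rewrite -ee eL /ep /r !hdotBl.
  have -> : hdot (hn *: du) e = hn * hdot du e by rewrite !(hdotC _ e) hdotZr.
  by ring.
have gL : hdot g e = hdot fn e - hdot a e - hdot du e by rewrite /g !hdotBl.
have eep := normB_sq e ep; rewrite (hdotC e ep) in eep.
(* Split [(g, e)] into [(g, ep)], which pairs with the past, and [(g, e - ep)]. This square bounds
   [2 * hn] times the second part by [2 * hn ^+ 2 * |g| ^+ 2] plus half of [|e - ep| ^+ 2]; the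
   other half survives on the left. *)
have young := sqr_ge0 `|(2 * hn) *: g - (e - ep)|.
rewrite normB_sq normrZ exprMn (ger0_norm (_ : 0 <= 2 * hn)) in young;
  last first.
  by rewrite mulr_ge0// ltW.
rewrite (hdotC _ (e - ep)) hdotZr (hdotC _ g) hdotBr gL in young.
have cs : hdot r e <= `|r| * `|e| by exact: le_trans (ler_norm _) (hdot_le_norm _ _).
have kE : kx * (hn * `|e| ^+ 2) <= kappa * (hn * `|e| ^+ 2).
  by rewrite ler_wpM2r// mulr_ge0 ?sqr_ge0// ltW.
have {}mono : hn * (eta * q) <= hn * (B s z (z - j y) - hdot a e + kx * `|e| ^+ 2).
  by rewrite ler_pM2l.
rewrite zL in test; move: mono test; set b := B s z (z - j y) => mono test.
nra.
Qed.

End embedded_banach_theory.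

Section exact_solution.
Context (R : realType) (H : hilbertType R) (V : embedded_banach H).

Lemma hoelder_seminorm_le (T gamma : R) (w : R -> H) (s t : R) :
  0 < gamma -> hoelder_on T gamma w -> 0 <= s <= T -> 0 <= t <= T ->
  `|w t - w s| <= hoelder_seminorm T gamma w * `|t - s| `^ gamma.
Proof.
move=> g0 hw sT tT; have [->|st] := eqVneq s t.
  by rewrite !subrr !normr0 powR0 ?gt_eqF// mulr0.
rewrite -ler_pdivrMr; last by rewrite powR_gt0 ?normr_gt0 ?subr_eq0 1?eq_sym.
by apply: ub_le_sup => //; exists s, t.
Qed.

Lemma is_derive_functional (B : normedModType R) (L : {linear B -> R})
    (f : R -> B) (x : R) (df : B) :
  continuous L -> is_derive x 1 f df -> is_derive x 1 (fun s => L (f s)) (L df).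
Proof.
move=> cL fdf.
have fx : (fun h : R => h^-1 *: ((f \o shift x) (h *: 1) - f x)) @ 0^' --> df.
  by rewrite -(@derive_val _ _ _ _ _ _ _ fdf);
    exact: (@ex_derive _ _ _ _ _ _ _ fdf).
have Lfx : (fun h : R => h^-1 *: (((fun s => L (f s)) \o shift x) (h *: 1) - L (f x)))
    @ 0^' --> L df.
  have -> : (fun h : R => h^-1 *: (((fun s => L (f s)) \o shift x) (h *: 1) - L (f x)))
    = L \o (fun h : R => h^-1 *: ((f \o shift x) (h *: 1) - f x)).
    have LZ r (b : B) : L (r *: b) = r * L b by exact: linearZ.
    by apply/funext => h /=; rewrite LZ [L (_ - _)]linearB.
  by apply: cvg_comp fx _; exact: cL.
apply: DeriveDef; first by apply/cvg_ex; exists (L df).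
by apply/cvg_lim.
Qed.

Lemma dual_eval_linear (v : V) : linear (fun phi : dual V => phi v : R).
Proof. by []. Qed.

Definition dual_eval (v : V) : {linear dual V -> R} :=
  HB.pack (fun phi : dual V => phi v : R)
    (GRing.isLinear.Build R (dual V) R *:%R _ (dual_eval_linear v)).

Lemma dual_eval_continuous (v : V) : continuous (fun phi : dual V => phi v).
Proof.
suff : bounded_near (dual_eval v) (nbhs (0 : dual V)).
  by move/linear_bounded_continuous.
apply/linear_boundedP; near=> r => phi.
rewrite (le_trans (dual_le_norm _ _))// mulrC ler_wpM2r// ?dual_norm_ge0//.
Unshelve. all: by end_near. Qed.

(* The mean value theorem applies to [s |-> (u s, emb v)_H] for each [v] in [V]:
   [u'] is only the derivative of [u] in the dual of [V]. *)
Lemma derivative_residual (T gamma : R) (A : R -> V -> dual V) (f : R -> H)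
    (u0 : H) (u u' : R -> H) (s t : R) :
  evolution_solution T A f u0 u u' -> hoelder_on T gamma u' ->
  0 < gamma -> 0 <= s -> s < t -> t <= T ->
  `|(t - s) *: u' t - (u t - u s)| <=
    (t - s) * (hoelder_seminorm T gamma u' * (t - s) `^ gamma).
Proof.
move=> sol hu g0 s0 st tT; set D := hoelder_seminorm _ _ _.
have ts : 0 < t - s by rewrite subr_gt0.
have D0 : 0 <= D * (t - s) `^ gamma.
  rewrite -[X in X `^ _](gtr0_norm ts).
  apply: le_trans (hoelder_seminorm_le g0 hu _ _) => //.
    by rewrite s0 (le_trans (ltW st)).
  by rewrite tT andbT (le_trans s0)// ltW.
apply: (norm_le_hdot_emb (V := V)); first by rewrite mulr_ge0// ltW.
move=> v; pose phi (r : R) := hdot (u r) (emb V v).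
have [c cst ctE] : exists2 c, c \in `]s, t[ &
    phi t - phi s = hdot (u' c) (emb V v) * (t - s).
  apply: (@MVT R phi (fun r => hdot (u' r) (emb V v))) => //.
    move=> r; rewrite in_itv/= => /andP[sr rt].
    apply: (@is_derive_functional _ (dual_eval v) (fun r => to_dual V (u r)) r
      (to_dual V (u' r))).
      exact: dual_eval_continuous.
    by apply: (evolution_derive sol);
      rewrite (le_lt_trans s0 sr) (lt_le_trans rt tT).
  (* The endpoints may be 0 and [T], where no derivative is given; continuity of [u] in [H] covers
     them. *)
  have /continuous_subspaceW : `[s, t] `<=` `[0, T].
    by apply: subset_itv; rewrite bnd_simp.
  move=> /(_ _ _ (evolution_continuous sol)) cu r.
  apply: (@cvg_comp _ _ _ u (hdot^~ (emb V v))); first exact: cu.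
  exact: hdot_continuous.
have -> : hdot ((t - s) *: u' t - (u t - u s)) (emb V v) =
    (t - s) * hdot (u' t - u' c) (emb V v).
  rewrite !hdotBl -/(phi t) -/(phi s) ctE.
  by rewrite !(hdotC _ (emb V v)) hdotZr; ring.
rewrite -mulrA ler_pM2l//.
apply: le_trans (ler_norm _) _; apply: le_trans (hdot_le_norm _ _) _.
rewrite ler_wpM2r//; move: cst; rewrite in_itv/= => /andP[sc ct].
apply: le_trans (hoelder_seminorm_le g0 hu _ _) _.
- by rewrite (le_trans s0 (ltW sc)) (le_trans (ltW ct) tT).
- by rewrite tT andbT (le_trans s0)// ltW.
rewrite gtr0_norm ?subr_gt0//.
have : 0 < (t - s) `^ gamma by rewrite powR_gt0.
move: D0 => /[swap] p0; rewrite pmulr_lge0// => D0.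
rewrite ler_wpM2l// ge0_ler_powR ?nnegrE// ?(ltW g0)// ?subr_ge0 ?(ltW ct) ?(ltW st)//.
by rewrite lerD2l lerN2 ltW.
Qed.

End exact_solution.

(** * Estimates in expectation *)

Lemma measurable_wrt_continuous (S : Type) (X Y : topologicalType)
    (F : set (set S)) (f : S -> X) (k : X -> Y) :
  continuous k -> measurable_wrt F [set: S] f ->
  measurable_wrt F [set: S] (fun w => k (f w)).
Proof.
move=> ck mf O oO; apply: (mf (k @^-1` O)).
by apply: open_comp => // z _; exact: ck.
Qed.

Lemma measurable_wrt_cst (S : Type) (X : topologicalType) (F : set (set S)) (c : X) :
  sigma_algebra [set: S] F -> measurable_wrt F [set: S] (fun=> c).
Proof.
move=> sF O _; rewrite setTI preimage_cst; case: ifP => _.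
  exact: sigma_algebra_setT.
by case: sF.
Qed.

Lemma ae_lebesgue_itv (R : realType) (Q : R -> Prop) (T a b : R) :
  {ae lebesgue_measure, forall t : R, 0 < t < T -> Q t} ->
  0 <= a -> a < b -> b <= T -> exists2 s, a < s < b & Q s.
Proof.
move=> Qae a0 ab bT; apply: contrapT => nQ.
have : lebesgue_measure.-negligible (`]a, b[ : set R).
  apply: negligibleS Qae => s; rewrite /= in_itv/= => /andP[as_ sb] H.
  apply: nQ; exists s; first by rewrite as_.
  by apply: H; rewrite (le_lt_trans a0 as_) (lt_le_trans sb bT).
move=> nab; have : lebesgue_measure (`]a, b[ : set R) = 0%E.
  by apply: measure_negligible; [exact: measurable_itv|exact: nab].
rewrite lebesgue_measure_itv/= lte_fin ab => /eqP.
by rewrite -EFinD eqe subr_eq0 gt_eqF.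
Qed.

(** Every interval of positive length contains good times. They are taken to the left of [t], since
    [t] may be the final time [T]. *)
Lemma ae_lebesgue_sequence (R : realType) (Q : R -> Prop) (T t : R) :
  {ae lebesgue_measure, forall r : R, 0 < r < T -> Q r} ->
  0 < t <= T -> exists s : nat -> R,
    [/\ forall k, 0 <= s k <= T, forall k, Q (s k) & s @ \oo --> t].
Proof.
move=> Qae /andP[t0 tT].
have /choice[s sP] (k : nat) :
    exists r, t - t / k.+1%:R < r < t /\ Q r.
  have [||r rt Qr] := @ae_lebesgue_itv R Q T (t - t / k.+1%:R) t Qae _ _ tT.
  - by rewrite subr_ge0 ler_pdivrMr// ler_peMr ?(ltW t0)// ler1n.
  - by rewrite ltrBlDr ltrDl divr_gt0.
  - by exists r.
exists s; split=> [k|k|]; last 1 first.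
- apply: (@squeeze_cvgr _ _ _ _ (fun k : nat => t - t * k.+1%:R^-1) (fun=> t)).
  + by apply: nearW => k; have [/andP[sk1 sk2] _] := sP k; rewrite !ltW.
  + rewrite -[X in _ --> X]subr0 -[X in _ - X](mulr0 t).
    apply: cvgB; first exact: cvg_cst.
    by apply: cvgMr; exact: cvg_harmonic.
  + exact: cvg_cst.
- have [/andP[sk1 sk2] _] := sP k.
  rewrite (le_trans (ltW sk2) tT) andbT; apply: le_trans (ltW sk1).
  by rewrite subr_ge0 ler_pdivrMr// ler_peMr ?(ltW t0)// ler1n.
- by have [] := sP k.
Qed.

Section complete_probability.
Context d (Om : measurableType d) (R : realType) (P : probability Om R).
Hypothesis P_complete : measure_is_complete P.

Lemma square_integrable_complete (H : normedModType R) (f : Om -> H) :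
  square_integrable P [set: Om] f ->
  measurable_wrt measurable [set: Om] f /\
  P.-integrable [set: Om] (fun w => (`|f w| ^+ 2)%:E).
Proof.
move=> [g [mg ig /filterS fg]].
have {}fg : {ae P, forall w, g w = f w} by apply: fg => w /(_ I).
have mf : measurable_wrt measurable [set: Om] f.
  exact: (ae_eq_measurable_wrt (@sigma_algebra_measurable _ Om) P_complete fg).
have mn (k : Om -> H) : measurable_wrt measurable [set: Om] k ->
    measurable_fun [set: Om] (fun w => (`|k w| ^+ 2)%:E).
  move=> mk; apply/measurable_EFinP; apply: measurable_funX.
  have := measurable_norm_comp 0 mk.
  by under eq_fun do rewrite subr0.
split => //; apply/integrableP; split; first exact: mn.
rewrite (ae_eq_integral (fun w => (`|g w| ^+ 2)%:E))//.
- by apply: measurableT_comp => //; exact: mn.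
- exact: mn.
- by apply: filterS fg => w gw _; rewrite gw; apply: gee0_abs;
    rewrite lee_fin sqr_ge0.
Qed.

(** The set of convergence is conull, hence in the sigma-algebra; multiplied by its indicator, the
    sequence converges everywhere, and the limit changes on a null set only. *)
Lemma ae_cvg_sigma_measurable (G : set (set Om)) (phi_ : nat -> Om -> R)
    (phi : Om -> R) (Y : set R) :
  P.-negligible `<=` <<s G >> ->
  (forall k Y, measurable Y -> <<s G >> (phi_ k @^-1` Y)) ->
  {ae P, forall w, phi_ k w @[k --> \oo] --> phi w} ->
  measurable Y -> <<s G >> (phi @^-1` Y).
Proof.
move=> Gnull mphi cphi mY.
pose A := [set w | phi_ k w @[k --> \oo] --> phi w].
have GA : <<s G >> A.
  have : P.-negligible (~` A) by exact: cphi.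
  move/Gnull => GA; rewrite -(setCK A) -setTD.
  exact: sigma_algebra_setD (smallest_sigma_algebra _ _) (sigma_algebra_setT (smallest_sigma_algebra _ _)) GA.
pose S := g_sigma_algebraType G.
have mI : measurable_fun [set: S] (\1_A : S -> R) by exact: measurable_indic.
have mp : measurable_fun [set: S] (fun w : S => phi w * \1_A w).
  apply: (@measurable_fun_cvg _ S R _ (fun k (w : S) => phi_ k w * \1_A w)) => [k|w _].
    apply: measurable_funM; last exact: mI.
    by move=> _ Z mZ; rewrite setTI; exact: mphi.
  rewrite indicE; case: (boolP (w \in A)) => [|_].
    by rewrite inE !mulr1; under eq_fun do rewrite mulr1.
  by under eq_fun do rewrite mulr0; rewrite mulr0; exact: cvg_cst.
have := mp measurableT Y mY; rewrite setTI.
apply: (ae_eq_preimage (mu := P)) => //; first exact: smallest_sigma_algebra.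
by apply: filterS cphi => w /= cw; rewrite indicE mem_set// mulr1.
Qed.

End complete_probability.

Section defect.
Context (R : realType) (H : hilbertType R) (V : embedded_banach H).
Context d (Om : measurableType d) (P : probability Om R).
Hypothesis P_complete : measure_is_complete P.
Context (dE : nat -> measure_display) (E : forall n, measurableType (dE n)).
Variable xi : forall n, {RV P >-> E n}.
Hypothesis xi_indep : mutually_independent xi.
Local Open Scope ereal_scope.

Lemma sigma_null_sub_xi n : P.-negligible `<=` sigma_xi xi n.
Proof.
by move=> A nA; apply: sub_sigma_algebra; right; exact: sub_sigma_algebra.
Qed.

(** Paired with a fixed vector, the defect is a scalar function of the current sample with mean
    zero, so its integral over any event of the independent past vanishes. *)
Lemma defect_mean0 (m : nat) (F X : Om -> H) (c : H) (mF mX : R) (v : V) (A : set Om) :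
  (forall Y, measurable Y ->
    sigma_xi xi m.+1 ((fun w => hdot (F w) (emb V v)) @^-1` Y)) ->
  (forall Y, measurable Y ->
    sigma_xi xi m.+1 ((fun w => hdot (X w) (emb V v)) @^-1` Y)) ->
  P.-integrable [set: Om] (fun w => (hdot (F w) (emb V v))%:E) /\
    \int[P]_w (hdot (F w) (emb V v))%:E = mF%:E ->
  P.-integrable [set: Om] (fun w => (hdot (X w) (emb V v))%:E) /\
    \int[P]_w (hdot (X w) (emb V v))%:E = mX%:E ->
  (mF - mX - hdot c (emb V v) = 0)%R ->
  P.-integrable [set: Om] (fun w => (hdot (F w - X w - c) (emb V v))%:E) /\
  (sigma_past xi m A -> \int[P]_(w in A) (hdot (F w - X w - c) (emb V v))%:E = 0).
Proof.
move=> sF sX [iF EF] [iX EX] m0.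
have ic : P.-integrable [set: Om] (fun=> (hdot c (emb V v))%:E).
  exact: finite_measure_integrable_cst.
have i1 : P.-integrable [set: Om]
    (fun w => (hdot (F w) (emb V v))%:E - (hdot (X w) (emb V v))%:E).
  exact: integrableB.
have gE w : (hdot (F w - X w - c) (emb V v))%:E =
    (hdot (F w) (emb V v))%:E - (hdot (X w) (emb V v))%:E - (hdot c (emb V v))%:E.
  by rewrite !hdotBl !EFinB.
have ig : P.-integrable [set: Om] (fun w => (hdot (F w - X w - c) (emb V v))%:E).
  by under eq_fun do rewrite gE; exact: integrableB.
split=> // sA.
pose S := g_sigma_algebraType (sigma_of xi m.+1 `|` sigma_null P).
have sg Y : measurable Y ->
    sigma_xi xi m.+1 ((fun w => hdot (F w - X w - c)%R (emb V v)) @^-1` Y).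
  have mS : measurable_fun [set: S]
      (fun w : S => hdot (F w) (emb V v) - hdot (X w) (emb V v) - hdot c (emb V v))%R.
    apply: measurable_funB => //; apply: measurable_funB.
      by move=> _ Z mZ; rewrite setTI; exact: sF.
    by move=> _ Z mZ; rewrite setTI; exact: sX.
  move=> mY; have := mS measurableT Y mY; rewrite setTI.
  have <- // : (fun w => hdot (F w - X w - c)%R (emb V v)) = (fun w : S =>
      hdot (F w) (emb V v) - hdot (X w) (emb V v) - hdot c (emb V v))%R.
  by apply/funext => w; rewrite !hdotBl.
have s0 : sigma_xi xi m.+1 set0 by exact: sigma_algebra0.
have [mA _ _] := sigma_past_xi_independence P_complete xi_indep sA s0.
apply: integral_independence0 => // [Y mY|].
  by have [] := sigma_past_xi_independence P_complete xi_indep sA (sg Y mY).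
under eq_integral do rewrite gE.
rewrite integralB// integralB// EF EX integral_cst//.
rewrite [X in _ - _ * X](_ : _ = 1) ?mule1//; last exact: probability_setT.
by rewrite -!EFinB m0.
Qed.

End defect.

Section energy_expectation.
Context d (Om : measurableType d) (R : realType) (P : probability Om R).
Local Open Scope ereal_scope.

Lemma ae_le_integrable (f g : Om -> R) :
  measurable_fun [set: Om] f -> (forall w, 0 <= f w)%R ->
  (forall w, 0 <= g w)%R -> P.-integrable [set: Om] (fun w => (g w)%:E) ->
  {ae P, forall w, (f w <= g w)%R} -> P.-integrable [set: Om] (fun w => (f w)%:E).
Proof.
move=> mf f0 g0 ig fg; have [mg gfin] := integrableP _ _ _ ig.
apply/integrableP; split; first exact/measurable_EFinP.
apply: le_lt_trans gfin; apply: ae_ge0_le_integral => //.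
- by apply: measurableT_comp => //; exact/measurable_EFinP.
- exact: measurableT_comp.
- by apply: filterS fg => w fg _; rewrite !gee0_abs ?lee_fin.
Qed.

Lemma integrable_axpy (k : R) (X Y : Om -> R) :
  P.-integrable [set: Om] (fun w => (X w)%:E) ->
  P.-integrable [set: Om] (fun w => (Y w)%:E) ->
  P.-integrable [set: Om] (fun w => (k * X w + Y w)%:E) /\
  (fine (\int[P]_w (k * X w + Y w)%:E) =
    k * fine (\int[P]_w (X w)%:E) + fine (\int[P]_w (Y w)%:E))%R.
Proof.
move=> iX iY.
have E w : (k * X w + Y w)%:E = k%:E * (X w)%:E + (Y w)%:E by [].
have ikX : P.-integrable [set: Om] (fun w => k%:E * (X w)%:E).
  exact: integrableZl.
split; first by under eq_fun do rewrite E; exact: integrableD.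
under eq_integral do rewrite E.
rewrite integralD// fineD ?integrable_fin_num// integralZl//.
by rewrite fineM ?integrable_fin_num.
Qed.

(** Four variables and a constant cover every linear combination used below; shorter ones are padded
    with zero coefficients. *)
Lemma integrable_affine (c1 c2 c3 c4 c5 : R) (X1 X2 X3 X4 : Om -> R) :
  P.-integrable [set: Om] (fun w => (X1 w)%:E) ->
  P.-integrable [set: Om] (fun w => (X2 w)%:E) ->
  P.-integrable [set: Om] (fun w => (X3 w)%:E) ->
  P.-integrable [set: Om] (fun w => (X4 w)%:E) ->
  let f w := (c1 * X1 w + (c2 * X2 w + (c3 * X3 w + (c4 * X4 w + c5))))%R in
  P.-integrable [set: Om] (fun w => (f w)%:E) /\
  (fine (\int[P]_w (f w)%:E) = c1 * fine (\int[P]_w (X1 w)%:E) +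
    (c2 * fine (\int[P]_w (X2 w)%:E) + (c3 * fine (\int[P]_w (X3 w)%:E) +
    (c4 * fine (\int[P]_w (X4 w)%:E) + c5))))%R.
Proof.
move=> i1 i2 i3 i4 f.
have i5 : P.-integrable [set: Om] (fun=> c5%:E).
  exact: finite_measure_integrable_cst.
have [j4 E4] := integrable_axpy c4 i4 i5.
have [j3 E3] := integrable_axpy c3 i3 j4.
have [j2 E2] := integrable_axpy c2 i2 j3.
have [j1 E1] := integrable_axpy c1 i1 j2.
split => //; rewrite E1 E2 E3 E4 integral_cst//.
by rewrite [X in fine (_ * X)](_ : _ = 1) ?mule1//; exact: probability_setT.
Qed.

(** [S] stands for the term that may fail to be measurable. The two conditions linking [Z], [G] and
    [Q] are the expansions of |e^{n-1} + h g|^2 >= 0 and |e^{n-1} - h g|^2 >= 0: the first keeps the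
    dominating map nonnegative, the second bounds [Q] by integrable squares. *)
Lemma energy_expectation (e D S Z G Q : Om -> R) (c h r rho : R) :
  (0 < c)%R -> (0 < h)%R -> (0 <= r)%R -> (r <= h * rho)%R ->
  (forall w, 0 <= e w)%R -> (forall w, 0 <= D w)%R -> (forall w, 0 <= S w)%R ->
  (forall w, 0 <= Z w)%R -> (forall w, 0 <= G w)%R ->
  (forall w, 0 <= Z w + h ^+ 2 * G w + 2 * h * Q w)%R ->
  (forall w, 2 * h * Q w <= Z w + h ^+ 2 * G w)%R ->
  measurable_fun [set: Om] e -> measurable_fun [set: Om] D ->
  P.-integrable [set: Om] (fun w => (Z w)%:E) ->
  P.-integrable [set: Om] (fun w => (G w)%:E) ->
  P.-integrable [set: Om] (fun w => (Q w)%:E) ->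
  \int[P]_w (Q w)%:E = 0 ->
  {ae P, forall w, c * e w ^+ 2 + 2^-1 * D w + 2 * h * S w <=
    Z w + 2 * h ^+ 2 * G w + 2 * h * Q w + 2 * r * e w}%R ->
  [/\ P.-integrable [set: Om] (fun w => (e w ^+ 2)%:E),
      P.-integrable [set: Om] (fun w => (D w)%:E),
      \int[P]_w (S w)%:E \is a fin_num &
      forall dl : R, (0 < dl)%R ->
      (c * fine (\int[P]_w (e w ^+ 2)%:E) + 2^-1 * fine (\int[P]_w (D w)%:E) +
       2 * h * fine (\int[P]_w (S w)%:E) <=
       fine (\int[P]_w (Z w)%:E) + 2 * h ^+ 2 * fine (\int[P]_w (G w)%:E) +
       h * (dl * fine (\int[P]_w (e w ^+ 2)%:E) + rho ^+ 2 / dl))%R].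
Proof.
move=> c0 h0 r0 rh e0 D0 S0 Z0 G0 ZGQ0 QZG me mD iZ iG iQ Q0 energy.
have me2 : measurable_fun [set: Om] (fun w => e w ^+ 2)%R by exact: measurable_funX.
(* A crude form of the estimate comes first: Young's inequality hides [c / 2 * e ^+ 2] on the left
   and [2 * h * Q <= Z + h ^+ 2 * G]; dividing by [c / 2] gives the coefficients [4 / c],
   [6 * h ^+ 2 / c] and [4 * r ^+ 2 / c ^+ 2]. *)
have ie2 : P.-integrable [set: Om] (fun w => (e w ^+ 2)%:E).
  apply: (@ae_le_integrable _
    (fun w => 4 / c * Z w + (6 * h ^+ 2 / c * G w + (0 * Q w +
      (0 * Q w + 4 * r ^+ 2 / c ^+ 2))))%R) => //.
  - by move=> w; rewrite sqr_ge0.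
  - move=> w; have ci : (0 <= c^-1)%R by rewrite invr_ge0 ltW.
    rewrite !mul0r !add0r -exprVn.
    apply: addr_ge0; first by rewrite !mulr_ge0.
    apply: addr_ge0; apply: mulr_ge0 => //; try exact: sqr_ge0.
      by rewrite mulr_ge0// mulr_ge0// sqr_ge0.
    by rewrite mulr_ge0// sqr_ge0.
  - exact: (integrable_affine _ _ _ _ _ _ _ _ _).1.
  - apply: filterS energy => w ew.
    have := QZG w; have := D0 w; have := S0 w => Sw Dw Qw.
    have hS : (0 <= h * S w)%R by rewrite mulr_ge0// ltW.
    have young : (2 * r * e w <= c / 2 * e w ^+ 2 + 2 * r ^+ 2 / c)%R.
      rewrite -subr_ge0.
      have -> : (c / 2 * e w ^+ 2 + 2 * r ^+ 2 / c - 2 * r * e w =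
        (c * e w - 2 * r) ^+ 2 / (2 * c))%R by field; rewrite gt_eqF.
      by rewrite divr_ge0 ?sqr_ge0 ?mulr_ge0// ltW.
    have : (c / 2 * e w ^+ 2 <= 2 * Z w + 3 * h ^+ 2 * G w + 2 * r ^+ 2 / c)%R.
      by lra.
    rewrite -(ler_pM2l (divr_gt0 (ltr0n R 2 : 0 < 2)%R c0)).
    rewrite !mul0r !add0r.
    by congr (_ <= _)%R; field; rewrite gt_eqF.
pose g w := (Z w + 2 * h ^+ 2 * G w + 2 * h * Q w)%R.
(* The whole estimate is divided by [2 * h], so that [S] stands with coefficient 1 as the lower
   integral lemma asks. The terms with [dl] come from Young's inequality for [2 * r * e] and
   [r <= h * rho]. *)
pose gd dl w := ((g w + h * dl * e w ^+ 2 + h * rho ^+ 2 / dl) / (2 * h))%R.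
have h2 : (0 < 2 * h)%R by rewrite mulr_gt0.
have gd0 dl w : (0 < dl)%R -> (0 <= gd dl w)%R.
  move=> dl0; rewrite divr_ge0// ?(ltW h2)//.
  have := ZGQ0 w; have := G0 w.
  have : (0 <= h * dl * e w ^+ 2)%R by rewrite mulr_ge0 ?sqr_ge0// mulr_ge0// ltW.
  have : (0 <= h * rho ^+ 2 / dl)%R by rewrite divr_ge0 ?(ltW dl0)// mulr_ge0 ?sqr_ge0// ltW.
  have : (0 <= h ^+ 2 * G w)%R by rewrite mulr_ge0 ?sqr_ge0.
  by rewrite /g; lra.
have igd dl : (0 < dl)%R -> P.-integrable [set: Om] (fun w => (gd dl w)%:E) /\
    (fine (\int[P]_w (gd dl w)%:E) = (fine (\int[P]_w (Z w)%:E) +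
     2 * h ^+ 2 * fine (\int[P]_w (G w)%:E) + h * (dl * fine (\int[P]_w (e w ^+ 2)%:E) +
     rho ^+ 2 / dl)) / (2 * h))%R.
  move=> dl0.
  have [] := integrable_affine (2 * h)^-1 h 1 (dl / 2) (rho ^+ 2 / (2 * dl)) iZ iG iQ ie2.
  have -> : (fun w => ((2 * h)^-1 * Z w + (h * G w + (1 * Q w + (dl / 2 * e w ^+ 2 +
      rho ^+ 2 / (2 * dl)))))%:E) = (fun w => (gd dl w)%:E).
    by apply/funext => w; congr EFin; rewrite /gd /g; field; rewrite !gt_eqF.
  move=> igd Egd; split=> //; rewrite Egd Q0/=.
  by field; rewrite !gt_eqF.
pose f1 w := ((c * e w ^+ 2 + 2^-1 * D w) / (2 * h))%R.
have mf1 : measurable_fun [set: Om] f1.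
  by apply: measurable_funM => //; apply: measurable_funD;
    exact: measurable_funM.
have f10 w : (0 <= f1 w)%R.
  by rewrite divr_ge0 ?(ltW h2)// addr_ge0// mulr_ge0 ?sqr_ge0// ltW.
have f1S dl : (0 < dl)%R -> {ae P, forall w, (f1 w + S w <= gd dl w)%R}.
  move=> dl0; apply: filterS energy => w ew.
  rewrite /f1 /gd -[S w](mulfK (lt0r_neq0 h2)) -mulrDl ler_pM2r ?invr_gt0//.
  rewrite (mulrC (S w)); apply: le_trans ew _; rewrite -/(g w) -!addrA lerD2l.
  have : (2 * (h * rho) * e w <= h * (dl * e w ^+ 2 + rho ^+ 2 / dl))%R.
    rewrite -subr_ge0.
    have -> : (h * (dl * e w ^+ 2 + rho ^+ 2 / dl) - 2 * (h * rho) * e w =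
      h * (dl * e w - rho) ^+ 2 / dl)%R by field; rewrite gt_eqF.
    by rewrite divr_ge0 ?(ltW dl0)// mulr_ge0 ?sqr_ge0// ltW.
  have : (2 * r * e w <= 2 * (h * rho) * e w)%R.
    by rewrite ler_wpM2r// ler_wpM2l.
  by rewrite mulrDr !mulrA; lra.
have main dl : (0 < dl)%R ->
    \int[P]_w (f1 w)%:E + \int[P]_w (S w)%:E <= \int[P]_w (gd dl w)%:E.
  move=> dl0; apply: ae_ge0_integralD_le.
  - by move=> w; rewrite lee_fin.
  - exact/measurable_EFinP.
  - by move=> w; rewrite lee_fin.
  - by move=> w; rewrite lee_fin gd0.
  - exact: measurable_int (igd _ dl0).1.
  - by apply: filterS (f1S _ dl0) => w; rewrite -EFinD lee_fin.
have fS : \int[P]_w (S w)%:E \is a fin_num.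
  rewrite ge0_fin_numE ?integral_ge0//; last by move=> w _; rewrite lee_fin.
  have := main 1%R ltr01; apply: contraTT; rewrite -leNgt leye_eq => /eqP ->.
  rewrite addey; last first.
    rewrite gt_eqF// (@lt_le_trans _ _ 0)// integral_ge0// => w _.
    by rewrite lee_fin.
  by rewrite -ltNge; apply: integrable_lty => //; exact: (igd _ ltr01).1.
have iD : P.-integrable [set: Om] (fun w => (D w)%:E).
  (* The factor [4 * h] undoes the weight [2^-1 / (2 * h)] of [D] in [f1]. *)
  apply: (@ae_le_integrable _ (fun w => 4 * h * gd 1%R w)%R) => //.
  - by move=> w; rewrite mulr_ge0 ?gd0// mulr_ge0// ltW.
  - by under eq_fun do rewrite EFinM; apply: integrableZl => //;
      exact: (igd _ ltr01).1.
  - apply: filterS (f1S _ ltr01) => w f1w.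
    have : (f1 w <= gd 1 w)%R by apply: le_trans f1w; rewrite lerDl.
    rewrite /f1 ler_pdivrMr// => f1g.
    have : (0 <= c * e w ^+ 2)%R by rewrite mulr_ge0 ?sqr_ge0// ltW.
    lra.
split => // dl dl0.
have := main _ dl0.
have [if1 Ef1] : P.-integrable [set: Om] (fun w => (f1 w)%:E) /\
    (fine (\int[P]_w (f1 w)%:E) = (c * fine (\int[P]_w (e w ^+ 2)%:E) +
      2^-1 * fine (\int[P]_w (D w)%:E)) / (2 * h))%R.
  have [] := integrable_affine (c / (2 * h)) (4 * h)^-1 0 0 0 ie2 iD iQ iQ.
  have -> : (fun w => (c / (2 * h) * e w ^+ 2 + ((4 * h)^-1 * D w + (0 * Q w +
      (0 * Q w + 0))))%:E) = (fun w => (f1 w)%:E).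
    by apply/funext => w; congr EFin; rewrite /f1; field; rewrite gt_eqF.
  move=> if1 Ef1; split=> //; rewrite Ef1.
  by field; rewrite gt_eqF.
have [igdl Egdl] := igd _ dl0.
rewrite -(fineK (integrable_fin_num measurableT if1)) -(fineK fS).
rewrite -(fineK (integrable_fin_num measurableT igdl)) Egdl Ef1 -EFinD lee_fin => le.
rewrite -(ler_pM2r (_ : 0 < (2 * h)^-1)%R) ?invr_gt0//; apply: le_trans le.
by rewrite mulrDl lerD2l mulrAC mulfV ?mul1r// gt_eqF.
Qed.

End energy_expectation.

(** * The error bound *)

Section expectation_functionals.
Context (R : realType) (H : hilbertType R) (V : embedded_banach H).
Context d (Om : measurableType d) (P : probability Om R).
Local Open Scope ereal_scope.

Lemma has_expectation_hdot (X : Om -> H) (m y : H) : has_expectation P X m ->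
  P.-integrable [set: Om] (fun w => (hdot (X w) y)%:E) /\
  \int[P]_w (hdot (X w) y)%:E = (hdot m y)%:E.
Proof.
move=> /(has_expectation_functional (L := hdot_left y)); apply.
exact: hdot_continuous.
Qed.

Lemma has_expectation_dual (X : Om -> dual V) (m : dual V) (v : V) :
  has_expectation P X m ->
  P.-integrable [set: Om] (fun w => (X w v)%:E) /\
  \int[P]_w (X w v)%:E = (m v)%:E.
Proof.
move=> /(has_expectation_functional (L := dual_eval v)); apply.
exact: dual_eval_continuous.
Qed.

Lemma ae_eq_integrable (f g : Om -> R) :
  measurable_fun [set: Om] g -> {ae P, forall w, f w = g w} ->
  P.-integrable [set: Om] (fun w => (f w)%:E) ->
  P.-integrable [set: Om] (fun w => (g w)%:E) /\
  \int[P]_w (g w)%:E = \int[P]_w (f w)%:E.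
Proof.
move=> mg fg iF; have [mf ffin] := integrableP _ _ _ iF.
have mg' : measurable_fun [set: Om] (fun w => (g w)%:E) by exact/measurable_EFinP.
split.
  apply/integrableP; split => //; apply: le_lt_trans ffin.
  rewrite (ae_eq_integral (fun w => `|(f w)%:E|))//.
  - exact: measurableT_comp.
  - exact: measurableT_comp.
  - by apply: filterS fg => w -> _.
apply: ae_eq_integral => //.
by apply: filterS fg => w -> _.
Qed.

End expectation_functionals.

Lemma sigma_algebra_sigma_past d (Om : measurableType d) (R : realType)
    (P : probability Om R) (dE : nat -> measure_display)
    (E : forall n, measurableType (dE n)) (xi : forall n, {RV P >-> E n}) n :
  sigma_algebra [set: Om] (sigma_past xi n).
Proof. exact: smallest_sigma_algebra. Qed.

Lemma sigma_algebra_sigma_xi d (Om : measurableType d) (R : realType)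
    (P : probability Om R) (dE : nat -> measure_display)
    (E : forall n, measurableType (dE n)) (xi : forall n, {RV P >-> E n}) n :
  sigma_algebra [set: Om] (sigma_xi xi n).
Proof. exact: smallest_sigma_algebra. Qed.

Section grid.
Context (R : realType) (N : nat) (t : nat -> R).
Hypothesis t_lt : forall n, (n < N)%N -> t n < t n.+1.

Lemma grid_le m n : (m <= n <= N)%N -> t m <= t n.
Proof.
move=> /andP[/subnK <-]; elim: (n - m)%N => [//|k IH] kN.
by rewrite (le_trans (IH (ltnW kN)))//= addSn ltW// t_lt// -addSn.
Qed.

Lemma step_le_mesh n : (1 <= n <= N)%N -> step t n <= mesh t N.
Proof.
move=> /andP[n1 nN]; rewrite /mesh; apply: le_bigmax_seq => //.
by rewrite mem_index_iota n1 ltnS.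
Qed.

Lemma sum_step : \sum_(1 <= i < N.+1) step t i = t N - t 0%N.
Proof. by rewrite big_add1/= -telescope_sumr. Qed.

End grid.

Lemma continuous_within_cvg (R : realType) (X : topologicalType) (A : set R)
    (f : R -> X) (s : nat -> R) (x : R) :
  {within A, continuous f} -> A x -> (forall k, A (s k)) -> s @ \oo --> x ->
  (fun k => f (s k)) @ \oo --> f x.
Proof.
move=> /subspace_continuousP cf Ax As sx U /(cf _ Ax) /sx sU.
have {}sU : \forall k \near \oo, A (s k) -> U (f (s k)) by exact: sU.
by apply: filterS sU => k; apply; exact: As.
Qed.

(** Along good times tending to [t], path continuity makes the pairing at [t] an almost sure limit
    of measurable ones, and the sigma-algebra contains the null sets. *)
Lemma continuous_sigma_xi (R : realType) (H : hilbertType R) d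
    (Om : measurableType d) (P : probability Om R) (dE : nat -> measure_display)
    (E : forall n, measurableType (dE n)) (xi : forall n, {RV P >-> E n}) n
    (X : Om -> R -> H) (T t : R) (y : H) (Y : set R) :
  0 < t <= T ->
  {ae P, forall w, {within `[0, T], continuous (X w)}} ->
  {ae lebesgue_measure, forall s : R, 0 < s < T ->
    measurable_wrt (sigma_xi xi n) [set: Om] (fun w => X w s)} ->
  measurable Y -> sigma_xi xi n ((fun w => hdot (X w t) y) @^-1` Y).
Proof.
move=> tT cX mX mY; have [s [s0T sQ st]] := ae_lebesgue_sequence mX tT.
apply: (ae_cvg_sigma_measurable (P := P)
  (phi_ := fun k w => hdot (X w (s k)) y)) mY.
- exact: sigma_null_sub_xi.
- move=> k Z mZ; apply: (measurable_wrt_comp (g := hdot^~ y)) (sQ k) _ mZ.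
    exact: sigma_algebra_sigma_xi.
  exact: hdot_continuous.
- apply: filterS cX => w cXw.
  have Xs : (fun k => X w (s k)) @ \oo --> X w t.
    apply: continuous_within_cvg cXw _ _ st => [|k]; rewrite /= in_itv/=.
      by case/andP: tT => /ltW -> ->.
    exact: s0T.
  apply: (cvg_comp (fun k => X w (s k)) (hdot^~ y) Xs).
  exact: hdot_continuous.
Qed.

(* All expectations are taken with respect to P: E_n and E_(xi_n) of a random
   variable measurable for sigma_past xi n, resp. sigma_xi xi n, are its total
   expectation. *)
Theorem theorem5p2 (R : realType) (H : hilbertType R) (H_sep : separable H)
    (V : embedded_banach H) (T p : R) (T_gt0 : 0 < T) (p_ge2 : 2 <= p)
    (A : R -> V -> dual V) (kappaA etaA betaA muA lambdaA : R)
    (A_cond : condition_A T p A kappaA etaA betaA muA lambdaA)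
    (f : R -> H) (f_L2 : square_integrable lebesgue_measure `]0, T[ f) (u0 : H)
    (d : measure_display) (Om : measurableType d) (P : probability Om R)
    (P_complete : measure_is_complete P)
    (dE : nat -> measure_display) (E : forall n, measurableType (dE n))
    (xi : forall n, {RV P >-> E n}) (xi_indep : mutually_independent xi)
    (Vx : forall n, E n -> embedded_banach H)
    (Vx_embeds : forall n, (0 < n)%N ->
      {ae P, forall w, densely_embeds V (Vx n (xi n w))})
    (Vx_bigcap : forall n, (0 < n)%N ->
      \bigcap_(w in [set: Om]) range (emb (Vx n (xi n w))) = range (emb V))
    (Vx_measurable : forall n, (0 < n)%N -> forall v : H,
      sigma_xi xi n [set w | range (emb (Vx n (xi n w))) v])
    (Ax : forall n (x : E n), R -> Vx n x -> dual (Vx n x))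
    (kappax etax betax mux lambdax : forall n, E n -> R)
    (Ax_cond : forall n, (0 < n)%N ->
      {ae P, forall w, condition_A T p (Ax n (xi n w)) (kappax n (xi n w))
        (etax n (xi n w)) (betax n (xi n w)) (mux n (xi n w))
        (lambdax n (xi n w))})
    (Ax_measurable : forall n, (0 < n)%N -> forall (s : R) (v : V), 0 <= s <= T ->
      measurable_wrt (sigma_xi xi n) [set: Om] (fun w => restrict_dual V
        (Ax n (xi n w) s (vlift (Vx n (xi n w)) (emb V v)))))
    (Ax_mean : forall n, (0 < n)%N -> forall (s : R) (v : V), 0 <= s <= T ->
      has_expectation P (fun w => restrict_dual V
        (Ax n (xi n w) s (vlift (Vx n (xi n w)) (emb V v)))) (A s v))
    (constants_ge0 : forall n, (0 < n)%N -> forall w,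
      [/\ 0 <= kappax n (xi n w), 0 <= etax n (xi n w), 0 <= betax n (xi n w),
          0 <= mux n (xi n w) & 0 <= lambdax n (xi n w)])
    (constants_measurable : forall n, (0 < n)%N ->
      [/\ measurable_fun [set: Om] (fun w => kappax n (xi n w)),
          measurable_fun [set: Om] (fun w => etax n (xi n w)),
          measurable_fun [set: Om] (fun w => betax n (xi n w)),
          measurable_fun [set: Om] (fun w => mux n (xi n w)) &
          measurable_fun [set: Om] (fun w => lambdax n (xi n w))])
    (kappa lambda : R) (kappa_ge0 : 0 <= kappa) (lambda_ge0 : 0 <= lambda)
    (kappax_le : forall n, (0 < n)%N ->
      {ae P, forall w, kappax n (xi n w) <= kappa})
    (lambdax_le : forall n, (0 < n)%N ->
      ('E_P[fun w => lambdax n (xi n w)] <= lambda%:E)%E)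
    (fx : forall n, E n -> R -> H)
    (fx_L2 : forall n, (0 < n)%N ->
      {ae P, forall w, square_integrable lebesgue_measure `]0, T[ (fx n (xi n w))})
    (fx_mean : forall n, (0 < n)%N ->
      {ae lebesgue_measure, forall t : R, 0 < t < T ->
        measurable_wrt (sigma_xi xi n) [set: Om] (fun w => fx n (xi n w) t) /\
        has_expectation P (fun w => fx n (xi n w) t) (f t)})
    (N : nat) (t : nat -> R) (t0 : t 0%N = 0) (tN : t N = T)
    (t_lt : forall n, (n < N)%N -> t n < t n.+1)
    (fx_continuous : forall n, (1 <= n <= N)%N ->
      {ae P, forall w, {within `[0, T], continuous (fx n (xi n w))}})
    (fx_grid_L2 : forall n, (1 <= n <= N)%N ->
      square_integrable P [set: Om] (fun w => fx n (xi n w) (t n)))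
    (fx_grid_mean : forall n, (1 <= n <= N)%N ->
      has_expectation P (fun w => fx n (xi n w) (t n)) (f (t n)))
    (U : nat -> Om -> H) (U_init : forall w, U 0%N w = u0)
    (U_measurable : forall n, (1 <= n <= N)%N ->
      measurable_wrt (sigma_past xi n) [set: Om] (U n))
    (U_scheme : forall n, (1 <= n <= N)%N ->
      {ae P, forall w, let W := Vx n (xi n w) in
        range (emb W) (U n w) /\
        to_dual W (U n w - U n.-1 w) +
          step t n *: Ax n (xi n w) (t n) (vlift W (U n w)) =
        step t n *: to_dual W (fx n (xi n w) (t n))})
    (u u' : R -> H) (u_solution : evolution_solution T A f u0 u u')
    (u_grid : forall n, (1 <= n <= N)%N ->
      to_dual V (f (t n)) =
      to_dual V (u' (t n)) + A (t n) (vlift V (u (t n))))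
    (gamma : R) (gamma01 : 0 < gamma <= 1) (u'_hoelder : hoelder_on T gamma u')
    (Axu_in_H : forall n, (1 <= n <= N)%N ->
      {ae P, forall w, let W := Vx n (xi n w) in
        range (to_dual W) (Ax n (xi n w) (t n) (vlift W (u (t n))))})
    (Axu_L2 : forall n, (1 <= n <= N)%N ->
      square_integrable P [set: Om] (fun w => let W := Vx n (xi n w) in
        to_H (Ax n (xi n w) (t n) (vlift W (u (t n)))))) :
  let h := mesh t N in
  let C := (1 - 2 * h * kappa)^-1 *
           expR (2 * kappa * T / (1 - 2 * h * kappa)) in
  let e n w := U n w - u (t n) in
  let Au i := to_H (A (t i) (vlift V (u (t i)))) in
  let Axu i w := to_H (Ax i (xi i w) (t i) (vlift (Vx i (xi i w)) (u (t i)))) in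
  let du := hoelder_seminorm T gamma u' in
  (forall n, (1 <= n <= N)%N -> 2 * kappa * step t n <= 2 * kappa * h) ->
  2 * kappa * h < 1 ->
  forall n, (1 <= n <= N)%N ->
  ('E_P[fun w => (`|e n w| ^+ 2)%R]
   + (2^-1)%:E * \sum_(1 <= i < n.+1) 'E_P[fun w => (`|e i w - e i.-1 w| ^+ 2)%R]
   + 2%:E * \sum_(1 <= i < n.+1) (step t i)%:E *
       'E_P[fun w =>
         (etax i (xi i w) * semi (vlift (Vx i (xi i w)) (e i w)) `^ p)%R]
   <= (8 * h * C)%:E * \sum_(1 <= i < N.+1) (step t i)%:E *
       'E_P[fun w =>
         (`|fx i (xi i w) (t i) - Axu i w - (f (t i) - Au i)| ^+ 2)%R]
      + (4 * h `^ (1 + 2 * gamma) * C * du ^+ 2 * T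
         + 5 * h `^ (2 * gamma) * C ^+ 2 * du ^+ 2 * T ^+ 2)%:E)%E.
Proof.
move=> h C e Au Axu du hstep kh n nN.
have /andP[gamma0 gamma1] := gamma01.
have N0 : (0 < N)%N by case/andP: nN => n1; apply: leq_trans.
have t_ge0 k : (k <= N)%N -> 0 <= t k.
  by move=> kN; rewrite -t0; apply: (grid_le t_lt).
have t_leT k : (k <= N)%N -> t k <= T.
  by move=> kN; rewrite -tN; apply: (grid_le t_lt); rewrite kN leqnn.
have step_gt0 k : (k < N)%N -> 0 < step t k.+1.
  by move=> kN; rewrite /step subr_gt0 t_lt.
have tS_gt0 k : (k < N)%N -> 0 < t k.+1.
  by move=> kN; apply: le_lt_trans (t_ge0 k (ltnW kN)) (t_lt _ kN).
have h_gt0 : 0 < h.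
  by apply: lt_le_trans (step_gt0 0%N N0) _; apply: step_le_mesh; rewrite N0.
have q_gt0 : 0 < 1 - 2 * h * kappa by rewrite subr_gt0 mulrAC.
have C_gt0 : 0 < C by rewrite mulr_gt0 ?invr_gt0 ?expR_gt0.
have du_ge0 : 0 <= du.
  have T0T : 0 <= T <= T by rewrite lexx ltW.
  have O0T : 0 <= (0 : R) <= T by rewrite lexx ltW.
  have := le_trans (normr_ge0 _) (hoelder_seminorm_le gamma0 u'_hoelder O0T T0T).
  by rewrite pmulr_lge0// powR_gt0// subr0 gtr0_norm.
(* The dense sequence of [H] is drawn from [V], so that its members are admissible test vectors for
   identities in the dual of [V]. *)
have [xs dxs] := dense_range_sequence (eb_separable V) (@emb_continuous _ _ V)
  (@emb_dense _ _ V).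
have me k : (k <= N)%N -> measurable_wrt (sigma_past xi k) [set: Om] (e k).
  move=> kN; apply: (measurable_wrt_continuous (k := fun y => y - u (t k))).
    by move=> y; apply: cvgB; [exact: cvg_id|exact: cvg_cst].
  case: k kN => [_|k kN]; last exact: U_measurable.
  rewrite (_ : U 0%N = fun=> u0); last exact/funext.
  exact: (measurable_wrt_cst _ (sigma_algebra_sigma_past _ _)).
have meO k : (k <= N)%N -> measurable_wrt measurable [set: Om] (e k).
  move=> kN O oO; apply: (sigma_past_measurable P_complete xi_indep).
  exact: me.
have norm_e k : (k <= N)%N -> measurable_fun [set: Om] (fun w => `|e k w|).
  move=> kN; have := measurable_norm_comp 0 (meO k kN).
  by under eq_fun do rewrite subr0.
have u_in k : (k < N)%N -> range (emb V) (u (t k.+1)).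
  by move=> kN; apply: (evolution_in_V u_solution); rewrite tS_gt0// t_leT.
pose F k w := fx k (xi k w) (t k).
have F2 k : (k < N)%N -> measurable_wrt measurable [set: Om] (F k.+1) /\
    P.-integrable [set: Om] (fun w => (`|F k.+1 w| ^+ 2)%:E).
  by move=> kN;
    exact: (square_integrable_complete P_complete (fx_grid_L2 k.+1 kN)).
have X2 k : (k < N)%N -> measurable_wrt measurable [set: Om] (Axu k.+1) /\
    P.-integrable [set: Om] (fun w => (`|Axu k.+1 w| ^+ 2)%:E).
  by move=> kN; exact: (square_integrable_complete P_complete (Axu_L2 k.+1 kN)).
(* By the equation at the grid point, A(t_n) u(t_n) is represented in [H] by f(t_n) - u'(t_n). Hence
   [g] is exactly the integrand on the right of the claim. *)
have AuE k : (k < N)%N -> f (t k.+1) - Au k.+1 = u' (t k.+1).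
  move=> kN; have /(congr1 (fun z => z - to_dual V (u' (t k.+1)))) := u_grid k.+1 kN.
  rewrite addrAC subrr add0r -to_dualB /Au => <-.
  by rewrite to_dualK subKr.
pose g k w := F k w - Axu k w - u' (t k).
have mg k : (k < N)%N -> measurable_fun [set: Om] (fun w => `|g k.+1 w|).
  move=> kN; have [mF _] := F2 _ kN; have [mX _] := X2 _ kN.
  (* Grouped as [(F - u') - Axu], this is a difference of two Borel maps, the first being a shift by
     a constant. *)
  under eq_fun do rewrite /g addrAC.
  apply: (measurable_norm_sub dxs) mX.
  apply: (measurable_wrt_continuous (k := fun y => y - u' (t k.+1))) mF.
  by move=> y; apply: cvgB; [exact: cvg_id|exact: cvg_cst].
have ig2 k : (k < N)%N -> P.-integrable [set: Om] (fun w => (`|g k.+1 w| ^+ 2)%:E).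
  move=> kN; have [mF iF] := F2 _ kN; have [mX iX] := X2 _ kN.
  have [ib _] := integrable_affine 4 4 0 0 (2 * `|u' (t k.+1)| ^+ 2) iF iX iF iX.
  apply: (ae_le_integrable _ _ _ ib).
  - by apply: measurable_funX; exact: mg.
  - by move=> w; exact: sqr_ge0.
  - move=> w; rewrite !mul0r !add0r !addr_ge0//.
  - apply: nearW => w; rewrite !mul0r !add0r.
    have := normD_sq_le (F k.+1 w - Axu k.+1 w) (- u' (t k.+1)).
    have := normD_sq_le (F k.+1 w) (- Axu k.+1 w).
    rewrite !normrN /g; lra.
have ig1 k : (k < N)%N -> P.-integrable [set: Om] (fun w => (`|g k.+1 w|)%:E).
  move=> kN.
  have [ib _] := integrable_affine 1 0 0 0 1 (ig2 _ kN) (ig2 _ kN) (ig2 _ kN) (ig2 _ kN).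
  apply: (ae_le_integrable _ _ _ ib).
  - exact: mg.
  - by [].
  - by move=> w; rewrite !mul0r !add0r mul1r addr_ge0// sqr_ge0.
  - apply: nearW => w; rewrite !mul0r !add0r mul1r.
    by have := sqr_ge0 (`|g k.+1 w| - 1); have := sqr_ge0 `|g k.+1 w|; nra.
have aeX k v0 : (k < N)%N -> emb V v0 = u (t k.+1) -> {ae P, forall w,
    restrict_dual V (Ax k.+1 (xi k.+1 w) (t k.+1)
      (vlift (Vx k.+1 (xi k.+1 w)) (emb V v0))) = to_dual V (Axu k.+1 w)}.
  move=> kN v0E; have k1 : (1 <= k.+1 <= N)%N by [].
  apply: filterS2 (Vx_embeds k.+1 isT) (Axu_in_H _ k1) => w VW [a _ aE].
  by rewrite v0E /Axu -aE to_dualK restrict_dual_to_dual.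
have g_mean0 k v : (k < N)%N ->
    P.-integrable [set: Om] (fun w => (hdot (g k.+1 w) (emb V v))%:E) /\
    forall A0, sigma_past xi k A0 ->
      (\int[P]_(w in A0) (hdot (g k.+1 w) (emb V v))%:E = 0)%E.
  move=> kN; have [v0 _ v0E] := u_in k kN.
  have tT : 0 <= t k.+1 <= T by rewrite t_ge0// t_leT.
  have sF Y : measurable Y ->
      sigma_xi xi k.+1 ((fun w => hdot (F k.+1 w) (emb V v)) @^-1` Y).
    apply: (continuous_sigma_xi (X := fun w => fx k.+1 (xi k.+1 w)) (T := T)).
    - by rewrite tS_gt0// t_leT.
    - exact: fx_continuous.
    - by apply: negligibleS (fx_mean k.+1 isT) => s /= nP sP;
        apply: nP => /sP[].
  have sX Y : measurable Y ->
      sigma_xi xi k.+1 ((fun w => hdot (Axu k.+1 w) (emb V v)) @^-1` Y).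
    move=> mY.
    have := measurable_wrt_comp (sigma_algebra_sigma_xi xi k.+1)
      (Ax_measurable k.+1 isT (t k.+1) v0 tT) (@dual_eval_continuous _ _ V v) mY.
    apply: (ae_eq_preimage (mu := P)); first exact: sigma_algebra_sigma_xi.
      exact: sigma_null_sub_xi.
    by apply: filterS (aeX k v0 kN v0E) => w ->.
  have EF := has_expectation_hdot (emb V v) (fx_grid_mean k.+1 kN).
  have [iR ER] := has_expectation_dual v (Ax_mean k.+1 isT (t k.+1) v0 tT).
  have mX : measurable_fun [set: Om] (fun w => hdot (Axu k.+1 w) (emb V v)).
    move=> _ Y mY; rewrite setTI.
    by apply: (sigma_xi_measurable P_complete xi_indep (n := k.+1)) => //;
      exact: sX.
  have EX : P.-integrable [set: Om] (fun w => (hdot (Axu k.+1 w) (emb V v))%:E) /\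
      (\int[P]_w (hdot (Axu k.+1 w) (emb V v))%:E = (A (t k.+1) v0 v)%:E)%E.
    rewrite -ER; apply: ae_eq_integrable iR => //.
    by apply: filterS (aeX k v0 kN v0E) => w ->.
  have m0 : hdot (f (t k.+1)) (emb V v) - A (t k.+1) v0 v -
      hdot (u' (t k.+1)) (emb V v) = 0.
    have := congr1 (fun phi : dual V => phi v) (u_grid k.+1 kN).
    rewrite -v0E vliftK.
    rewrite (_ : (to_dual V _ + _) v = hdot (u' (t k.+1)) (emb V v) + A (t k.+1) v0 v)//.
    by rewrite /= => ->; ring.
  (* The integrability clause does not involve the event, so [set0] is a placeholder. *)
  split; first exact: (defect_mean0 P_complete xi_indep set0 sF sX EF EX m0).1.
  by move=> A0; exact: (defect_mean0 P_complete xi_indep A0 sF sX EF EX m0).2.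
have orth k : (k < N)%N -> P.-integrable [set: Om] (fun w => (`|e k w| ^+ 2)%:E) ->
    P.-integrable [set: Om] (fun w => (hdot (g k.+1 w) (e k w))%:E) /\
    (\int[P]_w (hdot (g k.+1 w) (e k w))%:E = 0)%E.
  move=> kN ie; have [mF _] := F2 _ kN; have [mX _] := X2 _ kN.
  have iQ : P.-integrable [set: Om] (fun w => (hdot (g k.+1 w) (e k w))%:E).
    have [ib _] := integrable_affine 1 1 0 0 0 (ig2 _ kN) ie ie ie.
    apply: le_integrable ib => //.
      apply/measurable_EFinP; under eq_fun do rewrite /g hdotBl hdotBl.
      have mek := meO k (ltnW kN).
      apply: measurable_funB; first apply: measurable_funB.
      - exact: (measurable_hdot dxs).
      - exact: (measurable_hdot dxs).
      - apply: (measurable_hdot dxs) => //.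
        exact: (measurable_wrt_cst _ (@sigma_algebra_measurable _ Om)).
    move=> w _; rewrite !mul0r !addr0 !mul1r lee_fin.
    rewrite [leRHS]ger0_norm ?addr_ge0 ?sqr_ge0//.
    apply: le_trans (hdot_le_norm _ _) _.
    by have := sqr_ge0 (`|g k.+1 w| - `|e k w|); nra.
  split=> //; apply: (integral_hdot_eq0 dxs) iQ.
  - exact: sigma_algebra_sigma_past.
  - exact: (sigma_past_measurable P_complete xi_indep).
  - by apply: me; exact: ltnW.
  - exact: ig1.
  - by move=> i; exact: (g_mean0 k (xs i) kN).1.
  - by move=> i A0; exact: (g_mean0 k (xs i) kN).2.
pose S k w := etax k (xi k w) * semi (vlift (Vx k (xi k w)) (e k w)) `^ p.
(* This bounds the consistency error |r^n| per unit of time. *)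
pose rho := h `^ gamma * du.
have rho_ge0 : 0 <= rho by rewrite mulr_ge0 ?powR_ge0.
pose I (Z : Om -> R) := fine (\int[P]_w (Z w)%:E).
have I_ge0 Z : (forall w, 0 <= Z w) -> 0 <= I Z.
  by move=> Z0; apply: fine_ge0; apply: integral_ge0 => w _; rewrite lee_fin.
have S_ge0 k w : 0 <= S k.+1 w.
  by rewrite mulr_ge0 ?powR_ge0//; have [] := constants_ge0 k.+1 isT w.
(* Integrability of the previous error is a premise and that of the new one a conclusion, so that
   [ie] follows by induction. *)
have onestep k : (k < N)%N -> P.-integrable [set: Om] (fun w => (`|e k w| ^+ 2)%:E) ->
  [/\ P.-integrable [set: Om] (fun w => (`|e k.+1 w| ^+ 2)%:E),
      P.-integrable [set: Om] (fun w => (`|e k.+1 w - e k w| ^+ 2)%:E),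
      (\int[P]_w (S k.+1 w)%:E)%E \is a fin_num &
      forall dl : R, 0 < dl ->
      (1 - 2 * kappa * step t k.+1) * I (fun w => `|e k.+1 w| ^+ 2) +
       2^-1 * I (fun w => `|e k.+1 w - e k w| ^+ 2) +
       2 * step t k.+1 * I (S k.+1) <=
       I (fun w => `|e k w| ^+ 2) + 2 * step t k.+1 ^+ 2 * I (fun w => `|g k.+1 w| ^+ 2) +
       step t k.+1 * (dl * I (fun w => `|e k.+1 w| ^+ 2) + rho ^+ 2 / dl)].
  move=> kN ie; have [iQ Q0] := orth k kN ie.
  have k1 : (1 <= k.+1 <= N)%N by [].
  have sk := step_gt0 k kN.
  have skh := step_le_mesh t k1.
  have tT : 0 <= t k.+1 <= T by rewrite t_ge0// t_leT.
  pose r := `|step t k.+1 *: u' (t k.+1) - (u (t k.+1) - u (t k))|.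
  have rle : r <= step t k.+1 * rho.
    apply: le_trans (derivative_residual u_solution u'_hoelder gamma0
      (t_ge0 k (ltnW kN)) (t_lt _ kN) (t_leT _ kN)) _.
    rewrite /step/= ler_pM2l ?subr_gt0 ?t_lt// /rho mulrC ler_wpM2r//.
    by rewrite ge0_ler_powR ?nnegrE ?(ltW gamma0)// ltW.
  apply: (@energy_expectation _ _ _ P (fun w => `|e k.+1 w|) _ _ _ _
    (fun w => hdot (g k.+1 w) (e k w)) _ _ r rho) => //.
  - rewrite subr_gt0; apply: le_lt_trans kh.
    by rewrite ler_wpM2l// mulr_ge0.
  - exact: normr_ge0.
  - move=> w; have := sqr_ge0 `|e k w + step t k.+1 *: g k.+1 w|.
    rewrite normD_sq hdotZr (hdotC (e k w)) normrZ exprMn (gtr0_norm sk).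
    by lra.
  - move=> w; have := sqr_ge0 `|e k w - step t k.+1 *: g k.+1 w|.
    rewrite normB_sq hdotZr (hdotC (e k w)) normrZ exprMn (gtr0_norm sk).
    by lra.
  - exact: norm_e.
  - apply: measurable_funX; apply: (measurable_norm_sub dxs); apply: meO => //.
    exact: ltnW.
  - exact: ig2.
  have Hae : {ae P, forall w, kappax k.+1 (xi k.+1 w) <= kappa /\
      densely_embeds V (Vx k.+1 (xi k.+1 w))}.
    by apply: filterS2 (kappax_le k.+1 isT) (Vx_embeds k.+1 isT).
  move: Hae (Ax_cond k.+1 isT) => /filterS2/[apply] Hae.
  have {}Hae := Hae _ (fun w => @conj _ _).
  apply: filterS3 Hae (U_scheme k.+1 k1) (Axu_in_H k.+1 k1).
  move=> w [[kk VW] cond] [Uin Ueq] Xin.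
  exact: (scheme_energy (u (t k)) (u' (t k.+1)) VW cond kk tT sk (u_in k kN) Xin Uin Ueq).
have ie k : (k <= N)%N -> P.-integrable [set: Om] (fun w => (`|e k w| ^+ 2)%:E).
  elim: k => [_|k IH kN]; last by have [] := onestep k kN (IH (ltnW kN)).
  have e0 w : e 0%N w = 0.
    by rewrite /e U_init t0 (evolution_init u_solution) subrr.
  by under eq_fun do rewrite e0 normr0 expr0n; exact: integrable0.
pose a k := I (fun w => `|e k w| ^+ 2).
pose D k := I (fun w => `|e k w - e k.-1 w| ^+ 2).
pose G k := I (fun w => `|g k w| ^+ 2).
have a_ge0 k : 0 <= a k by apply: I_ge0 => w; exact: sqr_ge0.
have D_ge0 k : 0 <= D k by apply: I_ge0 => w; exact: sqr_ge0.
have G_ge0 k : 0 <= G k by apply: I_ge0 => w; exact: sqr_ge0.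
(* The absolute values give nonnegativity at index 0 and beyond [N], where the signs are unknown;
   [yE] removes them on the grid. *)
pose y k := 2^-1 * D k + 2 * `|step t k| * `|I (S k)|.
have y_ge0 k : 0 <= y k by rewrite addr_ge0// mulr_ge0// mulr_ge0.
pose b k := 2 * step t k ^+ 2 * G k.
have b_ge0 k : 0 <= b k by rewrite mulr_ge0// mulr_ge0// sqr_ge0.
have a0 : a 0%N = 0.
  rewrite /a /I (_ : (fun w => _) = cst 0%E) ?integral0//.
  apply/funext => w; rewrite /e U_init t0 (evolution_init u_solution) subrr.
  by rewrite normr0 expr0n.
have yE k : (k < N)%N -> y k.+1 = 2^-1 * D k.+1 + 2 * step t k.+1 * I (S k.+1).
  by move=> kN; rewrite /y (gtr0_norm (step_gt0 k kN)) ger0_norm// I_ge0.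
have rec k dl : (1 <= k <= N)%N -> 0 < dl ->
    (1 - 2 * kappa * step t k) * a k + y k <=
    a k.-1 + b k + step t k * (dl * a k + rho ^+ 2 / dl).
  case: k => // k kN dl0; have [_ _ _] := onestep k kN (ie k (ltnW kN)).
  by move=> /(_ dl dl0); rewrite yE// addrA.
have steps k : (1 <= k <= N)%N -> 0 < step t k by case: k => // k;
  exact: step_gt0.
have hT : \sum_(1 <= i < N.+1) step t i = T by rewrite sum_step tN t0 subr0.
have := gronwall_absorption kappa_ge0 steps (step_le_mesh t) kh hT T_gt0 a0 a_ge0
  y_ge0 b_ge0 N0 rec.
have nN' : (n <= N)%N by case/andP: nN.
move=> /(_ n nN'); rewrite -/h -/C => bound.
have EE (Z : Om -> R) : ('E_P[Z] = \int[P]_w (Z w)%:E)%E by rewrite unlock.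
(* Every expectation on the left is finite by [onestep], so the claim becomes an inequality between
   real numbers. *)
have lhsE : ('E_P[fun w => (`|e n w| ^+ 2)%R]
   + (2^-1)%:E * \sum_(1 <= i < n.+1) 'E_P[fun w => (`|e i w - e i.-1 w| ^+ 2)%R]
   + 2%:E * \sum_(1 <= i < n.+1) (step t i)%:E * 'E_P[S i])%E
   = (a n + \sum_(1 <= i < n.+1) y i)%:E.
  have -> : (\sum_(1 <= i < n.+1) 'E_P[fun w => (`|e i w - e i.-1 w| ^+ 2)%R] =
      (\sum_(1 <= i < n.+1) D i)%:E)%E.
    rewrite -sumEFin; apply: eq_big_nat => -[//|i] iN; rewrite EE /D /I fineK//.
    have iN' : (i < N)%N by apply: leq_trans nN'; rewrite -ltnS.
    apply: integrable_fin_num => //.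
    by have [] := onestep i iN' (ie i (ltnW iN')).
  have -> : (\sum_(1 <= i < n.+1) (step t i)%:E * 'E_P[S i] =
      (\sum_(1 <= i < n.+1) step t i * I (S i))%:E)%E.
    rewrite -sumEFin; apply: eq_big_nat => -[//|i] iN.
    have iN' : (i < N)%N by apply: leq_trans nN'; rewrite -ltnS.
    rewrite EE EFinM /I fineK//.
    by have [] := onestep i iN' (ie i (ltnW iN')).
  rewrite EE -(fineK (integrable_fin_num measurableT (ie n nN'))) -!EFinM -!EFinD.
  congr EFin; rewrite -/(I _) -/(a n) -addrA; congr (_ + _).
  rewrite !mulr_sumr -big_split/=; apply: eq_big_nat => -[//|i] iN.
  have iN' : (i < N)%N by apply: leq_trans nN'; rewrite -ltnS.
  by rewrite yE// mulrA.
have rhsE : (\sum_(1 <= i < N.+1) (step t i)%:E * 'E_P[fun w =>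
      (`|fx i (xi i w) (t i) - Axu i w - (f (t i) - Au i)| ^+ 2)%R] =
    (\sum_(1 <= i < N.+1) step t i * G i)%:E)%E.
  rewrite -sumEFin; apply: eq_big_nat => -[//|i] iN.
  rewrite EE EFinM /G /I AuE// fineK//.
  by apply: integrable_fin_num => //; exact: ig2.
rewrite -/(S _) lhsE rhsE -EFinM -EFinD lee_fin; apply: le_trans bound _.
(* By [step t i <= h], the bound obtained has the coefficients 4 and 4 where the claim has 8 and 5;
   the remaining summand of the claim is nonnegative. *)
have sG : 0 <= \sum_(1 <= i < N.+1) step t i * G i.
  rewrite big_nat sumr_ge0// => i iN; rewrite mulr_ge0// ltW// steps//.
have bG : \sum_(1 <= i < N.+1) b i <= 2 * h * \sum_(1 <= i < N.+1) step t i * G i.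
  rewrite mulr_sumr; apply: ler_sum_nat => i iN; rewrite /b expr2 !mulrA.
  rewrite ler_wpM2r// -!mulrA ler_wpM2l// ler_wpM2r ?step_le_mesh//.
  by rewrite ltW// steps.
have rho2 : rho ^+ 2 = h `^ (2 * gamma) * du ^+ 2.
  rewrite /rho exprMn; congr (_ * _).
  by rewrite mulrC powRrM powR_mulrn ?powR_ge0.
have t1 : 0 <= 4 * h `^ (1 + 2 * gamma) * C * du ^+ 2 * T.
  by rewrite mulr_ge0 ?(ltW T_gt0)// mulr_ge0 ?sqr_ge0// mulr_ge0 ?(ltW C_gt0)// mulr_ge0 ?powR_ge0.
have t2 : 0 <= C ^+ 2 * T ^+ 2 * (h `^ (2 * gamma) * du ^+ 2).
  by apply: mulr_ge0; apply: mulr_ge0; rewrite ?sqr_ge0 ?powR_ge0.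
have t3 : 2 * C * \sum_(1 <= i < N.+1) b i <=
    4 * (h * C * \sum_(1 <= i < N.+1) step t i * G i).
  have -> : 4 * (h * C * \sum_(1 <= i < N.+1) step t i * G i) =
    2 * C * (2 * h * \sum_(1 <= i < N.+1) step t i * G i) by ring.
  by rewrite ler_wpM2l// mulr_ge0// ltW.
have t4 : 0 <= h * C * \sum_(1 <= i < N.+1) step t i * G i.
  by rewrite mulr_ge0// mulr_ge0// ltW.
rewrite rho2; move: t1 t2 t3 t4.
set Z1 := 4 * _ * _ * _ * _; set Z2 := \sum_(1 <= i < N.+1) b i.
set Z3 := \sum_(1 <= i < N.+1) _; set Z4 := h `^ _ => t1 t2 t3 t4.
lra.
Qed.
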